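(* Let $\varepsilon>0$ and assume that $$\min\left\{\frac{2\varepsilon+2\beta_1+\lambda_5+2\lambda_1+2m\lambda_4}{\lambda_7+q\lambda_2},\ \frac{2\varepsilon+2\beta_2+\lambda_7+2\lambda_3+2m\lambda_4+2(\lambda_2+m_R\lambda_6)p}{\lambda_5+q\lambda_2}\right\}>1.$$ Let $(C(t),R(t),P_C(t),P_R(t))$ be the solution of $$\begin{cases} C'= \lambda_7 R -(\varepsilon+\beta_1+\lambda_5) C + (\lambda_1+m\lambda_4) P_C+\lambda_2RP_C\\ R'= \lambda_5 C-(\varepsilon+\beta_2+\lambda_7)R + (\lambda_3+m\lambda_4) P_R +(\lambda_2+m_R\lambda_6)RP_R\\ P_C'=(1-\alpha)\gamma + \beta_1 C+ \lambda_7 P_R - (\varepsilon+\lambda_5+\lambda_1+m\lambda_4) P_C - \lambda_2RP_C \\ P_R'=\alpha \gamma + \beta_2 R + \lambda_5 P_C - (\varepsilon+\lambda_7+\lambda_3+m\lambda_4) P_R - (\lambda_2+m_R\lambda_6) RP_R \end{cases}$$ with nonnegative initial condition $(C(t_0),R(t_0),P_C(t_0),P_R(t_0))=(C_0,R_0,P_{C,0},P_{R,0})$, and let $(C_a(t),R_a(t))$ be the solution of $$\begin{cases} C_a'=\lambda_7 R_a -(\varepsilon+\beta_1+\lambda_5) C_a + (\lambda_1+m\lambda_4+\lambda_2 R_a) (q-C_a)\\ R_a'=\lambda_5 C_a-(\varepsilon+\beta_2+\lambda_7)R_a + (\lambda_3+m\lambda_4+(\lambda_2+m_R\lambda_6)R_a)(p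 - R_a) \end{cases}$$ with initial condition $(C_a(t_0),R_a(t_0))=(C_0,R_0)$. Set $P_{R,a}(t)=p-R_a(t)$ and $P_{C,a}(t)=q-C_a(t)$. Then $$\lim_{t\to+\infty}\Big(|C(t)-C_a(t)|+|R(t)-R_a(t)|+|P_C(t)-P_{C,a}(t)|+|P_R(t)-P_{R,a}(t)|\Big)=0.$$
   Context: The parameters $\lambda_1,\dots,\lambda_7,\beta_1,\beta_2,\varepsilon,\gamma,m,m_R$ are nonnegative real constants and $\alpha\in[0,1]$. Notation: $$p=\frac{\gamma(\alpha\varepsilon+\lambda_5)}{\varepsilon(\varepsilon+\lambda_5+\lambda_7)},\qquad q=\frac{\gamma((1-\alpha)\varepsilon+\lambda_7)}{\varepsilon(\varepsilon+\lambda_5+\lambda_7)}.$$ *)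

(* Defs.v *)
From Stdlib Require Import Reals.
From Coquelicot Require Import Coquelicot.
Open Scope R_scope.

(* (q_inf, p_inf) is the equilibrium of the linear system satisfied by
   (C + P_C, R + P_R). *)
Definition p_inf (l5 l7 eps gam alpha : R) : R :=
  gam * (alpha * eps + l5) / (eps * (eps + l5 + l7)).

Definition q_inf (l5 l7 eps gam alpha : R) : R :=
  gam * ((1 - alpha) * eps + l7) / (eps * (eps + l5 + l7)).

(* x' = f on [t0, +oo) with x(t0) = x0; f t is the right-hand side already
   evaluated along the trajectory.  Values of x before t0 are irrelevant.
   For f right-continuous at t0, right-continuity of x together with the
   equation on (t0, +oo) gives the equation at t0 with the right derivative. *)
Definition ivp (t0 x0 : R) (x f : R -> R) : Prop :=
  x t0 = x0 /\
  filterlim x (at_right t0) (locally (x t0)) /\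
  forall t, t0 < t -> is_derive x t (f t).

(* The variables c, r, pc, pr stand for C, R, P_C, P_R. *)
Definition full_solution
    (l1 l2 l3 l4 l5 l6 l7 b1 b2 eps gam m mR alpha : R)
    (t0 c0 r0 pc0 pr0 : R) (c r pc pr : R -> R) : Prop :=
  ivp t0 c0 c (fun t =>
    l7 * r t - (eps + b1 + l5) * c t + (l1 + m * l4) * pc t
    + l2 * r t * pc t) /\
  ivp t0 r0 r (fun t =>
    l5 * c t - (eps + b2 + l7) * r t + (l3 + m * l4) * pr t
    + (l2 + mR * l6) * r t * pr t) /\
  ivp t0 pc0 pc (fun t =>
    (1 - alpha) * gam + b1 * c t + l7 * pr t
    - (eps + l5 + l1 + m * l4) * pc t - l2 * r t * pc t) /\
  ivp t0 pr0 pr (fun t =>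
    alpha * gam + b2 * r t + l5 * pc t
    - (eps + l7 + l3 + m * l4) * pr t - (l2 + mR * l6) * r t * pr t).

Definition reduced_solution
    (l1 l2 l3 l4 l5 l6 l7 b1 b2 eps m mR p q : R)
    (t0 c0 r0 : R) (ca ra : R -> R) : Prop :=
  ivp t0 c0 ca (fun t =>
    l7 * ra t - (eps + b1 + l5) * ca t
    + (l1 + m * l4 + l2 * ra t) * (q - ca t)) /\
  ivp t0 r0 ra (fun t =>
    l5 * ca t - (eps + b2 + l7) * ra t
    + (l3 + m * l4 + (l2 + mR * l6) * ra t) * (p - ra t)).

(* Main.v *)
Require Import Defs.
From Stdlib Require Import Reals Lra Psatz Classical_Prop.
From Coquelicot Require Import Coquelicot.
Open Scope R_scope.

(** Write u = C + P_C and v = R + P_R.  In the sum of the equations the nonlinear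
    terms cancel, so (u, v) solves a linear system whose equilibrium is (q, p), and
    u - q, v - p decay exponentially.  The reduced system is the full system on the
    invariant plane u = q, v = p: with P_C = q - C_a and P_R = p - R_a its solution
    solves the full system, although these two components may start negative.
    Hence everything follows from one statement about two solutions of
      C' = l7 R - (a + k1) C + k1 u + l2 R (u - C),
      R' = l5 C - (b + k3) R + k3 v + L R (v - R)
    (here L = l2 + mR l6) with the same nonnegative initial values (C, R) and with
    inputs u -> q, v -> p: their difference tends to zero
    ([driven_solutions_merge]).

    An energy estimate for the differences would need the term 2 (l2 + mR l6) p of
    the hypothesis with the opposite sign, so the proof uses instead that the system
    is cooperative and sublinear.  Assume L > 0.

    - Either R tends to zero along both solutions, or R stays away from zero along
      both ([R_vanishes_or_persists]).  If p = 0, then R <= v + o(1) vanishes.  If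
      p > 0 and k3 > 0, or k1 > 0 and l5 > 0, then P_R and P_C feed R forever.
      Otherwise a weight w1 C + w2 R with w1 >= 0 < w2 grows at a rate lam, up to
      decaying errors and a negative quadratic term: (w1, w2) is a left eigenvector
      of the linear part at the origin, and the sources do not reach it.  The sign
      of lam and the vanishing of the initial weight, both common to the two
      solutions, decide which case occurs.

    - If R -> 0, then C obeys a scalar linear equation in the limit and converges to
      k1 q / (a + k1) along both solutions ([C_limit]).

    - If R persists, so does C, and the ratios of the two solutions contract to 1:
      the inequalities C <= (1 + (1 + tau) s) C_a and R <= (1 + s) R_a, with s a
      slowly decaying exponential, persist once they hold ([ratio_comparison]),
      because the quadratic loss - L R^2 makes the larger solution grow relatively
      more slowly.

    If L = 0 the system for the differences is linear and the hypothesis makes the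
    sum of their squares decay ([linear_upper]).  All comparisons rest on the
    invariance of the quadrant under quasipositive linear differential inequalities
    ([quasipositive_nonneg]). *)

(** * Differential equations on a half-line *)

(** The initial value problem without its initial value.  Derivatives at t0 itself
    are never needed; right-continuity there is what links t0 to later times. *)
Definition ode (t0 : R) (x dx : R -> R) : Prop :=
  filterlim x (at_right t0) (locally (x t0)) /\
  forall t, t0 < t -> is_derive x t (dx t).

Lemma continuous_at_right (t : R) (x : R -> R) :
  continuous x t -> filterlim x (at_right t) (locally (x t)).
Proof.
intros cx P Px; destruct (cx P Px) as [d Pd]; exists d; auto.
Qed.

Lemma ode_from (t0 t1 : R) (x dx : R -> R) :
  t0 <= t1 -> ode t0 x dx -> ode t1 x dx.
Proof.
intros [lt01 | <-] [rcx derx]; [|now split].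
split; [|intros t ltt; apply derx; lra].
apply continuous_at_right, (ex_derive_continuous x); exists (dx t1); auto.
Qed.

Lemma ode_ext (t0 : R) (x y dx dy : R -> R) :
  (forall t, x t = y t) -> (forall t, t0 < t -> dx t = dy t) ->
  ode t0 x dx -> ode t0 y dy.
Proof.
intros exy edxy [rcx derx]; split.
- rewrite <- exy; apply filterlim_ext with x; auto.
- intros t ltt; rewrite <- edxy by easy.
  apply is_derive_ext with x; auto.
Qed.

Lemma ode_const (t0 k : R) : ode t0 (fun _ => k) (fun _ => 0).
Proof.
split; [apply filterlim_const | intros t _; apply (@is_derive_const R_AbsRing)].
Qed.

Lemma ode_plus (t0 : R) (x y dx dy : R -> R) :
  ode t0 x dx -> ode t0 y dy ->
  ode t0 (fun t => x t + y t) (fun t => dx t + dy t).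
Proof.
intros [rcx derx] [rcy dery]; split.
- exact (filterlim_comp_2 _ _ _ rcx rcy (filterlim_plus (x t0) (y t0))).
- intros t ltt; apply (is_derive_plus x y); auto.
Qed.

Lemma ode_mult (t0 : R) (x y dx dy : R -> R) :
  ode t0 x dx -> ode t0 y dy ->
  ode t0 (fun t => x t * y t) (fun t => dx t * y t + x t * dy t).
Proof.
intros [rcx derx] [rcy dery]; split.
- exact (filterlim_comp_2 _ _ _ rcx rcy (filterlim_mult (x t0) (y t0))).
- intros t ltt; apply (is_derive_mult x y); auto; exact Rmult_comm.
Qed.

Lemma ode_opp (t0 : R) (x dx : R -> R) :
  ode t0 x dx -> ode t0 (fun t => - x t) (fun t => - dx t).
Proof.
intros [rcx derx]; split.
- apply (filterlim_comp _ _ _ x Ropp _ _ _ rcx (filterlim_opp (x t0))).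
- intros t ltt; apply (is_derive_opp x); auto.
Qed.

Lemma ode_minus (t0 : R) (x y dx dy : R -> R) :
  ode t0 x dx -> ode t0 y dy ->
  ode t0 (fun t => x t - y t) (fun t => dx t - dy t).
Proof.
intros ox oy; exact (ode_plus _ _ _ _ _ ox (ode_opp _ _ _ oy)).
Qed.

Lemma ode_scal (t0 k : R) (x dx : R -> R) :
  ode t0 x dx -> ode t0 (fun t => k * x t) (fun t => k * dx t).
Proof.
intros ox; generalize (ode_mult _ _ _ _ _ (ode_const t0 k) ox).
apply ode_ext; intros; ring.
Qed.

Lemma ode_comp (t0 : R) (phi dphi x dx : R -> R) :
  (forall t, t0 <= t -> is_derive phi (x t) (dphi (x t))) -> ode t0 x dx ->
  ode t0 (fun t => phi (x t)) (fun t => dphi (x t) * dx t).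
Proof.
intros derphi [rcx derx]; split.
- apply (filterlim_comp _ _ _ x phi _ _ _ rcx).
  apply (ex_derive_continuous phi); exists (dphi (x t0)).
  apply derphi; lra.
- intros t ltt.
  rewrite Rmult_comm.
  apply (is_derive_comp phi x); [apply derphi; lra | auto].
Qed.

Lemma ode_exp (t0 k t1 : R) :
  ode t0 (fun t => exp (- k * (t - t1))) (fun t => - k * exp (- k * (t - t1))).
Proof.
pose (E := fun t => exp (- k * (t - t1))).
assert (der : forall t, is_derive E t (- k * E t)).
{ intros t; unfold E; auto_derive; [easy | unfold Rminus; ring]. }
split; [|intros t _; apply der].
apply (continuous_at_right t0 E), (ex_derive_continuous E); eexists; apply der.
Qed.

Lemma ode_nonincreasing (t0 t1 : R) (x dx : R -> R) :
  ode t0 x dx -> (forall t, t0 < t < t1 -> dx t <= 0) ->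
  forall s t, t0 <= s <= t -> t < t1 -> x t <= x s.
Proof.
intros [rcx derx] dx_le0 s t [les lest] lett1.
assert (interior : forall s t, t0 < s -> s <= t -> t < t1 -> x t <= x s).
{ clear s t les lest lett1; intros s t lts lest ltt.
  destruct (MVT_gen x s t dx) as [z [zin eqz]];
    rewrite ?Rmin_left, ?Rmax_right in * by lra.
  - intros z zin; apply derx; lra.
  - intros z zin; apply continuity_pt_filterlim.
    apply (ex_derive_continuous x); exists (dx z); apply derx; lra.
  - assert (dx z <= 0) by (apply dx_le0; lra); nra. }
destruct les as [lts | <-]; [now apply interior|].
destruct lest as [ltt | <-]; [|lra].
assert (Rbar_le (x t) (x t0)); [|easy].
apply (filterlim_le (F := at_right t0) (fun _ => x t) x); [|apply filterlim_const | exact rcx].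
assert (pos : 0 < t - t0) by lra.
exists (mkposreal _ pos); intros s bs lts.
apply interior; try easy.
change (Rabs (s - t0) < t - t0) in bs.
apply Rabs_lt_between in bs; lra.
Qed.

Lemma ode_locally_bounded (t0 : R) (x dx : R -> R) :
  ode t0 x dx ->
  forall t1, exists K, 0 <= K /\ forall t, t0 <= t <= t1 -> Rabs (x t) <= K.
Proof.
intros [rcx derx] t1.
(* Freezing x at its initial value before t0 makes it continuous everywhere. *)
pose (y := fun t => x (Rmax t0 t)).
assert (cont_x : forall t, t0 < t -> continuous x t).
{ intros t ltt; apply (ex_derive_continuous x); exists (dx t); auto. }
assert (cont_y : forall t, continuity_pt (fun t => Rabs (y t)) t).
{ intros t; apply continuity_pt_filterlim.
  apply (continuous_comp y Rabs); [|apply continuous_Rabs].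
  destruct (Rtotal_order t t0) as [lt | [-> | gt]].
  - apply continuous_ext_loc with (fun _ => x t0); [|apply continuous_const].
    apply (locally_interval _ t m_infty t0); try easy.
    intros s _ lts; unfold y; rewrite Rmax_left; [easy | simpl in lts; lra].
  - intros P Py; unfold filtermap.
    unfold y in Py; rewrite Rmax_left in Py by lra.
    destruct (rcx P Py) as [d Pd]; exists d; intros s bs; unfold y.
    destruct (Rle_lt_dec s t0) as [les | lts].
    + rewrite Rmax_left by lra; apply locally_singleton; exact Py.
    + rewrite Rmax_right by lra; now apply Pd.
  - apply continuous_ext_loc with x; [|auto].
    apply (locally_interval _ t t0 p_infty); try easy.
    intros s lts _; unfold y; rewrite Rmax_right; [easy | simpl in lts; lra]. }
destruct (Rle_lt_dec t0 t1) as [le01 | lt10].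
- destruct (continuity_ab_maj (fun t => Rabs (y t)) t0 t1 le01) as [M [maj _]];
    [auto|].
  exists (Rabs (y M)); split; [apply Rabs_pos|].
  intros t tin; specialize (maj t tin); simpl in maj.
  unfold y at 1 in maj; rewrite Rmax_right in maj; lra.
- exists 0; split; [lra | intros t tin; lra].
Qed.

(** The square of the negative part is continuously differentiable, unlike the
    negative part itself, so it can serve as an energy. *)
Definition negsq (y : R) : R := (Rmin y 0) ^ 2.

Lemma is_derive_negsq (y : R) : is_derive negsq y (2 * Rmin y 0).
Proof.
destruct (Rtotal_order y 0) as [lt | [-> | gt]].
- apply is_derive_ext_loc with (fun z => z ^ 2).
  + apply (locally_interval _ y m_infty 0); try easy.
    intros z _ ltz; unfold negsq; rewrite Rmin_left; [easy | simpl in ltz; lra].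
  + rewrite Rmin_left by lra; auto_derive; [easy | ring].
- rewrite Rmin_left, Rmult_0_r by lra.
  apply is_derive_Reals; intros e pe.
  exists (mkposreal e pe); intros h hn0 hlt; simpl in hlt.
  unfold negsq; rewrite Rplus_0_l, Rminus_0_r, (Rmin_left 0 0), (pow_i 2) by (lra || lia).
  rewrite Rminus_0_r.
  destruct (Rle_lt_dec h 0).
  + rewrite Rmin_left by lra; replace (h ^ 2 / h) with h by (field; easy); easy.
  + rewrite Rmin_right by lra.
    unfold Rdiv; rewrite (pow_i 2), Rmult_0_l, Rabs_R0 by lia; lra.
- apply is_derive_ext_loc with (fun z => 0).
  + apply (locally_interval _ y 0 p_infty); try easy.
    intros z ltz _; unfold negsq; rewrite Rmin_right; [|simpl in ltz; lra].
    symmetry; apply (pow_i 2); lia.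
  + rewrite Rmin_right, Rmult_0_r by lra; apply (@is_derive_const R_AbsRing).
Qed.

(** The energy N = (f^-)^2 + (g^-)^2 vanishes at t0, and where f < 0 the hypotheses
    give f' >= K f - K g^-, so that N' <= 4 K N; hence N = 0 forever.  The
    coefficients a1 and a2 are bounded above only, which is what makes the lemma
    applicable with strongly dissipative diagonal terms. *)
Lemma quasipositive_nonneg (t0 : R) (f g df dg a1 b1 a2 b2 : R -> R) :
  ode t0 f df -> ode t0 g dg -> 0 <= f t0 -> 0 <= g t0 ->
  (forall t, t0 < t -> a1 t * f t + b1 t * g t <= df t) ->
  (forall t, t0 < t -> a2 t * g t + b2 t * f t <= dg t) ->
  (forall t1, exists K, forall t, t0 < t < t1 ->
     a1 t <= K /\ 0 <= b1 t <= K /\ a2 t <= K /\ 0 <= b2 t <= K) ->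
  forall t, t0 <= t -> 0 <= f t /\ 0 <= g t.
Proof.
intros of og f0 g0 ineqf ineqg bnd t let0.
destruct (bnd (t + 1)) as [K HK].
pose (N := fun t => negsq (f t) + negsq (g t)).
pose (h := fun t => exp (- (4 * K) * (t - t0)) * N t).
assert (Nt : h t <= h t0).
{ apply (ode_nonincreasing t0 (t + 1) h
           (fun s => - (4 * K) * exp (- (4 * K) * (s - t0)) * N s
              + exp (- (4 * K) * (s - t0))
                * (2 * Rmin (f s) 0 * df s + 2 * Rmin (g s) 0 * dg s))); try lra.
  - apply ode_mult; [apply ode_exp|].
    apply ode_plus; apply (ode_comp _ negsq (fun y => 2 * Rmin y 0));
      eauto using is_derive_negsq.
  - intros s [lts ltst]; unfold N.
    destruct (HK s) as (A1 & B1 & A2 & B2); [lra|].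
    specialize (ineqf s lts); specialize (ineqg s lts).
    assert (pe := exp_pos (- (4 * K) * (s - t0))).
    assert (key : 2 * Rmin (f s) 0 * df s + 2 * Rmin (g s) 0 * dg s
                  <= 4 * K * (negsq (f s) + negsq (g s))); [|nra].
    assert (minus_part : forall x y dx a b, a <= K -> 0 <= b <= K -> a * x + b * y <= dx ->
      2 * Rmin x 0 * dx <= 3 * K * negsq x + K * negsq y).
    { clear - K; intros x y dx a b ha hb hd; unfold negsq.
      assert (m2 : y >= Rmin y 0) by (apply Rle_ge, Rmin_l).
      assert (n2 : Rmin y 0 <= 0) by apply Rmin_r.
      destruct (Rle_lt_dec x 0) as [lex | gtx].
      - rewrite (Rmin_left x 0) by easy.
        assert (dx >= K * x + K * Rmin y 0) by nra.
        assert (0 <= K) by lra; generalize (pow2_ge_0 (x - Rmin y 0)); nra.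
      - rewrite (Rmin_right x 0) by lra; nra. }
    generalize (minus_part _ _ _ _ _ A1 B1 ineqf) (minus_part _ _ _ _ _ A2 B2 ineqg); lra. }
assert (N0 : N t0 = 0).
{ unfold N, negsq; rewrite !Rmin_right by easy; ring. }
unfold h in Nt; rewrite N0, Rmult_0_r in Nt.
assert (pe := exp_pos (- (4 * K) * (t - t0))).
unfold N, negsq in Nt.
assert (sq : forall y, Rmin y 0 ^ 2 <= 0 -> 0 <= y).
{ intros y le; generalize (Rmin_l y 0); assert (Rmin y 0 = 0) by nra; lra. }
assert (pf := pow2_ge_0 (Rmin (f t) 0)); assert (pg := pow2_ge_0 (Rmin (g t) 0)).
split; apply sq; nra.
Qed.

Lemma ode_nonneg (t0 : R) (f df a : R -> R) :
  ode t0 f df -> 0 <= f t0 ->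
  (forall t, t0 < t -> a t * f t <= df t) ->
  (forall t1, exists K, forall t, t0 < t < t1 -> a t <= K) ->
  forall t, t0 <= t -> 0 <= f t.
Proof.
intros of f0 ineq bnd t let0.
apply (quasipositive_nonneg t0 f f df df a (fun _ => 0) a (fun _ => 0)); auto.
- intros s lts; generalize (ineq s lts); lra.
- intros s lts; generalize (ineq s lts); lra.
- intros t1; destruct (bnd t1) as [K HK]; exists (Rmax K 0); intros s hs.
  generalize (HK s hs) (Rmax_l K 0) (Rmax_r K 0); lra.
Qed.

Notation eventually_R P := (Rbar_locally p_infty P).

Lemma eventually_ge (T : R) : eventually_R (fun t => T <= t).
Proof. exists T; intros; lra. Qed.

Lemma exp_decay_eventually (nu t0 e : R) :
  0 < nu -> 0 < e -> eventually_R (fun t => exp (- nu * (t - t0)) <= e).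
Proof.
intros pnu pe; exists (t0 - ln e / nu); intros t ltt.
rewrite <- (exp_ln e pe); left; apply exp_increasing.
assert (nu * (t - t0) > - ln e); [|lra].
replace (- ln e) with (nu * ((t0 - ln e / nu) - t0)) by (field; lra).
apply Rmult_gt_compat_l; lra.
Qed.

Lemma exp_decay_le1 (nu t0 t : R) :
  0 <= nu -> t0 <= t -> 0 < exp (- nu * (t - t0)) <= 1.
Proof.
intros; split; [apply exp_pos|].
rewrite <- exp_0; destruct (Req_dec (nu * (t - t0)) 0).
- right; f_equal; lra.
- left; apply exp_increasing; nra.
Qed.

(** The comparison function c / k - A exp (- k (t - T)) solves y' = c - k y and
    starts below y when A is large. *)
Lemma relaxation_eventually_ge (t0 k : R) (y dy : R -> R) (c e : R) :
  ode t0 y dy -> 0 < k -> 0 < e ->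
  eventually_R (fun t => c - k * y t <= dy t) ->
  eventually_R (fun t => c / k - e <= y t).
Proof.
intros oy pk pe [M HM].
pose (T := Rmax t0 (M + 1)).
assert (T0 : t0 <= T) by apply Rmax_l.
assert (TM : M < T) by (unfold T; generalize (Rmax_r t0 (M + 1)); lra).
clearbody T.
apply (ode_from t0 T) in oy; [|easy].
pose (A := Rabs (y T - c / k)).
assert (lower : forall t, T <= t -> 0 <= y t - c / k + A * exp (- k * (t - T))).
{ apply (ode_nonneg T _ (fun t => dy t - 0 + A * (- k * exp (- k * (t - T))))
           (fun _ => - k)).
  - apply (ode_plus _ (fun t => y t - c / k)).
    + apply ode_minus; [exact oy | apply ode_const].
    + apply ode_scal, ode_exp.
  - rewrite Rminus_diag, Rmult_0_r, exp_0, Rmult_1_r; unfold A.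
    generalize (Rle_abs (- (y T - c / k))); rewrite Rabs_Ropp; lra.
  - intros t ltt; assert (Mt : M < t) by lra; assert (H := HM t Mt).
    assert (k * (c / k) = c) by (field; lra); nra.
  - intros t1; exists 0; intros; lra. }
assert (pA : 0 <= A) by apply Rabs_pos.
assert (small : 0 < e / (A + 1)) by (apply Rdiv_lt_0_compat; lra).
generalize (filter_and _ _ (eventually_ge T)
              (exp_decay_eventually k T _ pk small)).
apply filter_imp; intros t [leT lee].
specialize (lower t leT).
assert (A * exp (- k * (t - T)) <= e); [|lra].
apply Rle_trans with (A * (e / (A + 1))); [now apply Rmult_le_compat_l|].
assert (e / (A + 1) * (A + 1) = e) by (field; lra); nra.
Qed.

Lemma ode_affine (t0 k t1 : R) : ode t0 (fun t => k * (t - t1)) (fun _ => k).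
Proof.
pose (A := fun t => k * (t - t1)).
assert (der : forall t, is_derive A t k).
{ intros t; unfold A; auto_derive; [easy | ring]. }
split; [|intros t _; apply der].
apply (continuous_at_right t0 A), (ex_derive_continuous A); eexists; apply der.
Qed.

Lemma is_lim_eventually (f : R -> R) (l : R) :
  (forall e, 0 < e -> eventually_R (fun t => Rabs (f t - l) <= e)) ->
  is_lim f p_infty l.
Proof.
intros H; apply is_lim_spec; intros e.
assert (pe : 0 < e / 2) by (generalize (cond_pos e); lra).
generalize (H _ pe); apply filter_imp; intros t; generalize (cond_pos e); lra.
Qed.

Lemma eventually_is_lim (f : R -> R) (l e : R) :
  is_lim f p_infty l -> 0 < e -> eventually_R (fun t => Rabs (f t - l) <= e).
Proof.
intros lf pe; apply is_lim_spec in lf.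
generalize (lf (mkposreal e pe)); apply filter_imp; intros t; simpl; lra.
Qed.

Lemma is_lim_dominated (f g : R -> R) (K : R) :
  eventually_R (fun t => Rabs (f t) <= K * g t) ->
  is_lim g p_infty 0 -> is_lim f p_infty 0.
Proof.
intros dom lg; apply is_lim_eventually; intros e pe.
pose (K1 := Rabs K + 1).
assert (pK : 0 < K1) by (unfold K1; generalize (Rabs_pos K); lra).
generalize (filter_and _ _ dom (eventually_is_lim _ _ _ lg (Rdiv_lt_0_compat _ _ pe pK))).
apply filter_imp; intros t [dt gt]; rewrite Rminus_0_r in *.
apply Rle_trans with (1 := dt), Rle_trans with (1 := Rle_abs _).
rewrite Rabs_mult.
apply Rle_trans with (K1 * (e / K1)); [|right; field; lra].
apply Rmult_le_compat; try apply Rabs_pos; [unfold K1; lra | easy].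
Qed.

Lemma is_lim_exp_decay (nu t0 : R) :
  0 < nu -> is_lim (fun t => exp (- nu * (t - t0))) p_infty 0.
Proof.
intros pnu; apply is_lim_eventually; intros e pe.
generalize (exp_decay_eventually nu t0 e pnu pe); apply filter_imp; intros t lee.
rewrite Rminus_0_r, Rabs_pos_eq; [easy | left; apply exp_pos].
Qed.

Lemma relaxation_is_lim (t0 k : R) (y dy : R -> R) (c : R) :
  ode t0 y dy -> 0 < k ->
  is_lim (fun t => dy t + k * y t - c) p_infty 0 ->
  is_lim (fun t => y t - c / k) p_infty 0.
Proof.
intros oy pk lg; apply is_lim_eventually; intros e pe.
assert (pd : 0 < k * (e / 2)) by nra.
assert (near := eventually_is_lim _ _ _ lg pd).
assert (pe2 : 0 < e / 2) by lra.
assert (low : eventually_R (fun t => (c - k * (e / 2)) / k - e / 2 <= y t)).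
{ apply (relaxation_eventually_ge t0 k y dy); auto.
  revert near; apply filter_imp; intros t ht; apply Rabs_le_between in ht; lra. }
assert (high : eventually_R (fun t => (- c - k * (e / 2)) / k - e / 2 <= - y t)).
{ apply (relaxation_eventually_ge t0 k _ _ _ _ (ode_opp _ _ _ oy)); auto.
  revert near; apply filter_imp; intros t ht; apply Rabs_le_between in ht; lra. }
generalize (filter_and _ _ low high); apply filter_imp; intros t [lo hi].
replace ((c - k * (e / 2)) / k) with (c / k - e / 2) in lo by (field; lra).
replace ((- c - k * (e / 2)) / k) with (- (c / k) - e / 2) in hi by (field; lra).
apply Rabs_le_between; lra.
Qed.

Definition eventually_pos (f : R -> R) : Prop :=
  exists c, 0 < c /\ eventually_R (fun t => c <= f t).

Lemma relaxation_eventually_pos (t0 k c : R) (y dy : R -> R) :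
  ode t0 y dy -> 0 < k -> 0 < c ->
  eventually_R (fun t => c - k * y t <= dy t) -> eventually_pos y.
Proof.
intros oy pk pc H; exists (c / k - c / k / 2).
assert (0 < c / k) by now apply Rdiv_lt_0_compat.
split; [lra|].
apply (relaxation_eventually_ge t0 k y dy); auto; lra.
Qed.

(** A Barbalat argument: V decreases to a limit, so it eventually loses less than any
    given amount; but whenever x reaches e, the bound on its speed of descent keeps it
    above e / 2 for a fixed time, during which V loses a fixed amount. *)
Lemma dissipation_is_lim (t0 c K : R) (V dV x dx : R -> R) :
  ode t0 V dV -> ode t0 x dx -> 0 < c -> 0 <= K ->
  (forall t, t0 <= t -> 0 <= V t) -> (forall t, t0 <= t -> 0 <= x t) ->
  (forall t, t0 < t -> dV t <= - c * x t ^ 2) ->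
  (forall t, t0 < t -> - K <= dx t) ->
  is_lim x p_infty 0.
Proof.
intros oV ox pc pK V0 x0 HV Hx; apply is_lim_eventually; intros e pe.
assert (decV : forall s t, t0 <= s <= t -> V t <= V s).
{ intros s t hst; apply (ode_nonincreasing t0 (t + 1) V dV); auto; try lra.
  intros z hz; generalize (HV z (proj1 hz)) (pow2_ge_0 (x z)); nra. }
(* Once x reaches e it stays above e / 2 for a time 2 h, and V loses at least D
   during the first half of that time. *)
pose (h := e / (4 * (K + 1))); pose (D := c * (e / 2) ^ 2 * h).
assert (ph : 0 < h) by (apply Rdiv_lt_0_compat; lra).
assert (Kh : K * (2 * h) <= e / 2).
{ replace (e / 2) with ((K + 1) * (2 * h)) by (unfold h; field; lra); nra. }
assert (pD : 0 < D).
{ apply Rmult_lt_0_compat; [apply Rmult_lt_0_compat|]; auto; nra. }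
clearbody h.
destruct (completeness (fun y => exists t, t0 <= t /\ y = - V t)) as [m [ub lub]].
{ exists 0; intros y [t [ht ->]]; generalize (V0 t ht); lra. }
{ exists (- V t0), t0; split; [lra | easy]. }
assert (exT : exists T, t0 <= T /\ m - D < - V T).
{ apply NNPP; intros nex.
  assert (m <= m - D); [|lra].
  apply lub; intros y [t [ht ->]].
  destruct (Rle_lt_dec (- V t) (m - D)); [easy|].
  exfalso; apply nex; exists t; auto. }
destruct exT as [T [leT VT]].
exists T; intros t ltt.
rewrite Rminus_0_r, Rabs_pos_eq by (apply x0; lra).
apply Rnot_lt_le; intros big.
assert (xlow : forall s, t <= s <= t + 2 * h -> e / 2 <= x s).
{ intros s hs.
  assert (- x s + (- K) * (s - t) <= - x t + (- K) * (t - t)); [|nra].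
  apply (ode_nonincreasing t (s + 1) (fun z => - x z + (- K) * (z - t))
           (fun z => - dx z + - K)); try lra.
  - apply ode_plus; [|apply ode_affine].
    apply ode_opp, ode_from with t0; auto; lra.
  - intros z hz; generalize (Hx z); lra. }
assert (drop : V (t + h) + (c * (e / 2) ^ 2) * (t + h - t)
               <= V t + (c * (e / 2) ^ 2) * (t - t)).
{ refine (ode_nonincreasing t (t + 2 * h) (fun z => V z + (c * (e / 2) ^ 2) * (z - t))
           (fun z => dV z + c * (e / 2) ^ 2) _ _ t (t + h) _ _); try lra.
  - apply ode_plus; [|apply ode_affine].
    apply ode_from with t0; auto; lra.
  - intros z hz.
    assert (t0z : t0 < z) by lra; assert (zin : t <= z <= t + 2 * h) by lra.
    assert (sq : (e / 2) ^ 2 <= x z ^ 2) by (apply pow_incr; split; [lra | auto]).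
    generalize (HV z t0z) (Rmult_le_compat_l c _ _ (Rlt_le _ _ pc) sq); lra. }
assert (- V (t + h) <= m) by (apply ub; exists (t + h); split; [lra | easy]).
assert (V t <= V T) by (apply decV; lra).
unfold D in *; nra.
Qed.

(** * Cooperative systems driven by converging totals *)

Section DrivenSystem.

Context (l2 L l5 l7 k1 k3 a b p q : R).
Context (hl2 : 0 <= l2 <= L) (hl5 : 0 <= l5) (hl7 : 0 <= l7).
Context (hk1 : 0 <= k1) (hk3 : 0 <= k3) (ha : 0 < a) (hb : 0 < b).
Context (hp : 0 <= p) (hq : 0 <= q).
Context (hpq : 0 < p -> 0 < q) (hinfl : 0 < l7 + l2 * q).

Definition rate_C (c r u : R -> R) (t : R) : R :=
  l7 * r t - (a + k1) * c t + k1 * u t + l2 * r t * (u t - c t).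

Definition rate_R (c r v : R -> R) (t : R) : R :=
  l5 * c t - (b + k3) * r t + k3 * v t + L * r t * (v t - r t).

(** The differences u - c and v - r stand for P_C and P_R, which may be negative for
    the reduced system; the last two clauses of [drv_decay] bound their negative parts.
    The constant B serves as bound and as amplitude so that two solutions can share
    it. *)
Record driven_solution (t0 nu B : R) (c r u v : R -> R) : Prop := {
  drv_nu : 0 < nu;
  drv_C : ode t0 c (rate_C c r u);
  drv_R : ode t0 r (rate_R c r v);
  drv_bounds : forall t, t0 <= t ->
    (0 <= c t <= B) /\ (0 <= r t <= B) /\ (0 <= u t <= B) /\ (0 <= v t <= B);
  drv_decay : forall t, t0 <= t ->
    let E := B * exp (- nu * (t - t0)) in
    Rabs (u t - q) <= E /\ Rabs (v t - p) <= E /\ - E <= u t - c t /\ - E <= v t - r t;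
  drv_PC : 0 < q -> eventually_pos (fun t => u t - c t);
  drv_PR : 0 < p -> eventually_pos (fun t => v t - r t)
}.

(** ** Long-time behaviour of one solution *)

Section OneSolution.

Context (t0 nu B : R) (c r u v : R -> R).
Context (sol : driven_solution t0 nu B c r u v).

Let nu_pos : 0 < nu := drv_nu _ _ _ _ _ _ _ sol.

Lemma bound_nonneg : 0 <= B.
Proof.
destruct (drv_bounds _ _ _ _ _ _ _ sol t0) as [h _]; lra.
Qed.

Lemma decay_eventually (e : R) :
  0 < e -> eventually_R (fun t => B * exp (- nu * (t - t0)) <= e).
Proof.
intros pe; assert (B0 := bound_nonneg).
assert (ps : 0 < e / (B + 1)) by (apply Rdiv_lt_0_compat; lra).
generalize (exp_decay_eventually nu t0 _ nu_pos ps); apply filter_imp; intros t H.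
apply Rle_trans with (B * (e / (B + 1))); [now apply Rmult_le_compat_l|].
assert (e / (B + 1) * (B + 1) = e) by (field; lra); nra.
Qed.

(** When R -> 0 the equation of C becomes C' = - (a + k1) C + k1 q + o(1). *)
Lemma C_limit :
  is_lim r p_infty 0 ->
  is_lim (fun t => c t - k1 * q / (a + k1)) p_infty 0.
Proof.
intros R0; apply (relaxation_is_lim t0 (a + k1) c _ _ (drv_C _ _ _ _ _ _ _ sol)); [lra|].
assert (lE := is_lim_exp_decay nu t0 nu_pos).
apply is_lim_dominated with (K := l7 + l2 * B + k1 * B)
  (g := fun t => r t + exp (- nu * (t - t0))).
- generalize (eventually_ge t0); apply filter_imp; intros t leT.
  destruct (drv_bounds _ _ _ _ _ _ _ sol t leT) as (bC & bR & bu & bv).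
  destruct (drv_decay _ _ _ _ _ _ _ sol t leT) as (du & dv & _ & _).
  unfold rate_C.
  set (E := exp (- nu * (t - t0))) in *.
  replace (_ - _) with (l7 * r t + k1 * (u t - q) + l2 * r t * (u t - c t)) by ring.
  assert (pE : 0 < E) by apply exp_pos.
  assert (B0 := bound_nonneg).
  apply Rabs_le_between in du; apply Rabs_le_between.
  assert (k1 * (u t - q) <= k1 * (B * E)) by (apply Rmult_le_compat_l; lra).
  assert (- (k1 * (B * E)) <= k1 * (u t - q)) by nra.
  assert (0 <= l2 * r t) by nra.
  assert (l2 * r t * (u t - c t) <= l2 * r t * B) by (apply Rmult_le_compat_l; lra).
  assert (- (l2 * r t * B) <= l2 * r t * (u t - c t)) by nra.
  assert (0 <= l7 * r t) by nra.
  assert (0 <= l7 * E) by nra.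
  assert (0 <= l2 * B * E) by (apply Rmult_le_pos; nra).
  assert (0 <= k1 * B * r t) by (apply Rmult_le_pos; nra).
  split; nra.
- replace (Finite 0) with (Finite (0 + 0)) by (f_equal; ring).
  now apply is_lim_plus'.
Qed.

(** The influx l7 R + l2 R P_C into C is at least (l7 + l2 inf P_C) R, and
    l7 + l2 q > 0 makes this coefficient positive. *)
Lemma C_pos_of_R_pos : 0 < q -> eventually_pos r -> eventually_pos c.
Proof.
intros q0 [m1 [pr Hr]].
destruct (drv_PC _ _ _ _ _ _ _ sol q0) as [m0 [pc Hc]].
assert (infl : 0 < l7 + l2 * m0).
{ destruct (Req_dec l7 0); [|nra].
  assert (0 < l2) by nra; nra. }
apply (relaxation_eventually_pos t0 a ((l7 + l2 * m0) * m1) c _ (drv_C _ _ _ _ _ _ _ sol));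
  auto; [nra|].
generalize (filter_and _ _ Hr Hc); apply filter_imp; intros t [hr hc].
unfold rate_C.
assert (l2 * m0 <= l2 * (u t - c t)) by nra.
assert ((l7 + l2 * m0) * m1 <= (l7 + l2 * (u t - c t)) * r t).
{ apply Rmult_le_compat; nra. }
nra.
Qed.

Lemma C_pos_of_k1 : 0 < q -> 0 < k1 -> eventually_pos c.
Proof.
intros q0 pk.
destruct (drv_PC _ _ _ _ _ _ _ sol q0) as [m0 [pc Hc]].
apply (relaxation_eventually_pos t0 a (k1 * m0) c _ (drv_C _ _ _ _ _ _ _ sol));
  auto; [nra|].
generalize (filter_and _ _ (eventually_ge t0) Hc); apply filter_imp; intros t [leT hc].
destruct (drv_bounds _ _ _ _ _ _ _ sol t leT) as (_ & bR & _).
unfold rate_C.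
assert (0 <= l2 * r t * (u t - c t)) by (apply Rmult_le_pos; nra).
assert (0 <= l7 * r t) by nra.
nra.
Qed.

Lemma R_pos_of_k3 : 0 < p -> 0 < k3 -> eventually_pos r.
Proof.
intros p0 pk.
destruct (drv_PR _ _ _ _ _ _ _ sol p0) as [m0 [pc Hc]].
apply (relaxation_eventually_pos t0 b (k3 * m0) r _ (drv_R _ _ _ _ _ _ _ sol));
  auto; [nra|].
generalize (filter_and _ _ (eventually_ge t0) Hc); apply filter_imp; intros t [leT hc].
destruct (drv_bounds _ _ _ _ _ _ _ sol t leT) as (bC & bR & _).
unfold rate_R.
assert (0 <= L * r t * (v t - r t)) by (apply Rmult_le_pos; nra).
assert (0 <= l5 * c t) by nra.
nra.
Qed.

Lemma R_pos_of_C_pos : 0 < p -> 0 < l5 -> eventually_pos c -> eventually_pos r.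
Proof.
intros p0 pl [m1 [pr Hr]].
destruct (drv_PR _ _ _ _ _ _ _ sol p0) as [m0 [pc Hc]].
apply (relaxation_eventually_pos t0 b (l5 * m1) r _ (drv_R _ _ _ _ _ _ _ sol));
  auto; [nra|].
generalize (filter_and _ _ (eventually_ge t0) (filter_and _ _ Hr Hc));
  apply filter_imp; intros t [leT [hr hc]].
destruct (drv_bounds _ _ _ _ _ _ _ sol t leT) as (bC & bR & _).
unfold rate_R.
assert (0 <= L * r t * (v t - r t)) by (apply Rmult_le_pos; nra).
nra.
Qed.

(** With k3 = 0 and w1 k1 = 0 the sources k1 u and k3 v drop out of the derivative of
    w1 c + w2 r, which then grows at the rate lam near zero. *)
Section LeftEigenvector.

Context (w1 w2 lam : R) (hw1 : 0 <= w1) (hw2 : 0 < w2).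
Context (eig_C : - a * w1 + l5 * w2 = lam * w1).
Context (eig_R : (l7 + l2 * q) * w1 + (L * p - b) * w2 = lam * w2).
Context (hk3_0 : k3 = 0) (hwk1 : w1 * k1 = 0).

Definition weight (t : R) : R := w1 * c t + w2 * r t.

Definition dweight (t : R) : R :=
  lam * weight t + (w1 * l2 * (u t - q - c t) + w2 * L * (v t - p - r t)) * r t.

Lemma ode_weight : ode t0 weight dweight.
Proof.
assert (oC := ode_scal _ w1 _ _ (drv_C _ _ _ _ _ _ _ sol)).
assert (oR := ode_scal _ w2 _ _ (drv_R _ _ _ _ _ _ _ sol)).
generalize (ode_plus _ _ _ _ _ oC oR); apply ode_ext; [easy|].
intros t _; unfold dweight, weight, rate_C, rate_R; rewrite hk3_0.
transitivity ((- a * w1 + l5 * w2) * c t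
  + ((l7 + l2 * q) * w1 + (L * p - b) * w2) * r t + w1 * k1 * (u t - c t)
  + (w1 * l2 * (u t - q - c t) + w2 * L * (v t - p - r t)) * r t); [ring|].
rewrite eig_C, eig_R, hwk1; ring.
Qed.

Lemma weight_nonneg (t : R) : t0 <= t -> 0 <= weight t /\ w2 * r t <= weight t.
Proof.
intros leT; destruct (drv_bounds _ _ _ _ _ _ _ sol t leT) as (bC & bR & _).
unfold weight; split; nra.
Qed.

(** Relative growth rates of the weight are bounded, hence the weight neither leaves
    zero nor reaches it in finite time. *)
Lemma dweight_bound :
  exists K, 0 <= K /\ forall t, t0 <= t -> Rabs (dweight t) <= K * weight t.
Proof.
assert (B0 := bound_nonneg).
pose (M := w1 * l2 * (B + B + q) + w2 * L * (B + B + p)).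
assert (M0 : 0 <= M).
{ unfold M; apply Rplus_le_le_0_compat; apply Rmult_le_pos; nra. }
assert (M20 : 0 <= M / w2) by (apply Rdiv_le_0_compat; easy).
exists (Rabs lam + M / w2); split; [generalize (Rabs_pos lam); lra|].
intros t leT.
destruct (drv_bounds _ _ _ _ _ _ _ sol t leT) as (bC & bR & bu & bv).
destruct (weight_nonneg t leT) as [W0 RW].
unfold dweight; apply Rle_trans with (1 := Rabs_triang _ _).
rewrite !Rabs_mult, (Rabs_pos_eq (weight t)), (Rabs_pos_eq (r t)) by easy.
rewrite Rmult_plus_distr_r; apply Rplus_le_compat_l.
assert (coef : Rabs (w1 * l2 * (u t - q - c t) + w2 * L * (v t - p - r t)) <= M).
{ apply Rle_trans with (1 := Rabs_triang _ _).
  unfold M; rewrite !Rabs_mult, !(Rabs_pos_eq _ hw1), (Rabs_pos_eq w2), (Rabs_pos_eq l2),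
    (Rabs_pos_eq L) by lra.
  apply Rplus_le_compat; apply Rmult_le_compat_l; try nra;
    apply Rabs_le_between; lra. }
apply Rle_trans with (M * r t); [now apply Rmult_le_compat_r|].
replace (M * r t) with (M / w2 * (w2 * r t)) by (field; lra).
now apply Rmult_le_compat_l.
Qed.

Lemma R_vanishes_of_weight_zero : weight t0 = 0 -> is_lim r p_infty 0.
Proof.
intros W0; destruct dweight_bound as [K [K0 HK]].
assert (Wle : forall t, t0 <= t -> 0 <= - weight t).
{ apply (ode_nonneg t0 _ _ (fun _ => K) (ode_opp _ _ _ ode_weight)); [lra | |].
  - intros t ltt; generalize (HK t (Rlt_le _ _ ltt)); intros H.
    apply Rabs_le_between in H; lra.
  - intros t1; exists K; intros; lra. }
apply is_lim_eventually; intros e pe.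
generalize (eventually_ge t0); apply filter_imp; intros t leT.
destruct (weight_nonneg t leT) as [Wt RW].
destruct (drv_bounds _ _ _ _ _ _ _ sol t leT) as (_ & bR & _).
specialize (Wle t leT).
assert (r t = 0) by nra.
rewrite Rminus_0_r, Rabs_pos_eq; lra.
Qed.

(** Adding (K / nu) exp (- nu (t - t0)) to the weight compensates the decaying errors
    u - q and v - p, and leaves a nonincreasing function that loses at least
    w2 L R^2: the critical eigenvalue 0 is thus covered by the quadratic loss. *)
Lemma R_vanishes_of_nonpos_eigenvalue : 0 < L -> lam <= 0 -> is_lim r p_infty 0.
Proof.
intros pL lam0; assert (B0 := bound_nonneg).
pose (K := (w1 * l2 + w2 * L) * B * B).
assert (K0 : 0 <= K).
{ unfold K; repeat apply Rmult_le_pos; auto; nra. }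
pose (V := fun t => weight t + K / nu * exp (- nu * (t - t0))).
pose (dV := fun t => dweight t + K / nu * (- nu * exp (- nu * (t - t0)))).
apply (dissipation_is_lim t0 (w2 * L) ((b + k3) * B + L * B * B) V dV r (rate_R c r v)).
- apply ode_plus; [exact ode_weight | apply ode_scal, ode_exp].
- exact (drv_R _ _ _ _ _ _ _ sol).
- nra.
- apply Rplus_le_le_0_compat; [nra | repeat apply Rmult_le_pos; lra].
- intros t leT; unfold V.
  assert (0 <= K / nu * exp (- nu * (t - t0))).
  { apply Rmult_le_pos; [now apply Rdiv_le_0_compat | left; apply exp_pos]. }
  generalize (weight_nonneg t leT); lra.
- intros t leT; destruct (drv_bounds _ _ _ _ _ _ _ sol t leT) as (_ & bR & _); lra.
- intros t ltt.
  assert (leT : t0 <= t) by lra.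
  destruct (drv_bounds _ _ _ _ _ _ _ sol t leT) as (bC & bR & _).
  destruct (drv_decay _ _ _ _ _ _ _ sol t leT) as (du & dv & _ & _).
  destruct (weight_nonneg t leT) as [Wt _].
  unfold dV, dweight.
  assert (pE := exp_pos (- nu * (t - t0))).
  set (E := exp (- nu * (t - t0))) in *.
  replace (K / nu * (- nu * E)) with (- (K * E)) by (field; lra).
  apply Rabs_le_between in du; apply Rabs_le_between in dv.
  assert (lam * weight t <= 0) by nra.
  assert (w1l2 : 0 <= w1 * l2) by nra.
  assert (w2L : 0 <= w2 * L) by nra.
  assert (w1 * l2 * (u t - q - c t) <= w1 * l2 * (B * E)) by (apply Rmult_le_compat_l; lra).
  assert (w2 * L * (v t - p) <= w2 * L * (B * E)) by (apply Rmult_le_compat_l; lra).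
  assert (coef : (w1 * l2 * (u t - q - c t) + w2 * L * (v t - p - r t)) * r t
          <= ((w1 * l2 + w2 * L) * (B * E) - w2 * L * r t) * r t).
  { apply Rmult_le_compat_r; lra. }
  assert ((w1 * l2 + w2 * L) * (B * E) * r t <= (w1 * l2 + w2 * L) * (B * E) * B).
  { apply Rmult_le_compat_l; [|lra].
    apply Rmult_le_pos; [lra | apply Rmult_le_pos; lra]. }
  replace (K * E) with ((w1 * l2 + w2 * L) * (B * E) * B) by (unfold K; ring).
  lra.
- intros t ltt.
  assert (leT : t0 <= t) by lra.
  destruct (drv_bounds _ _ _ _ _ _ _ sol t leT) as (bC & bR & bu & bv).
  unfold rate_R.
  assert (0 <= l5 * c t) by nra.
  assert (0 <= k3 * v t) by nra.
  assert ((b + k3) * r t <= (b + k3) * B) by (apply Rmult_le_compat_l; lra).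
  assert (L * r t * (v t - r t) >= L * r t * (- B)) by (apply Rle_ge, Rmult_le_compat_l; nra).
  assert (L * r t * B <= L * B * B) by (apply Rmult_le_compat_r; [lra | nra]).
  lra.
Qed.

Lemma weight_stays_pos (t : R) : 0 < weight t0 -> t0 <= t -> 0 < weight t.
Proof.
intros W0 leT; destruct dweight_bound as [K [K0 HK]].
assert (H : 0 <= weight t - weight t0 * exp (- K * (t - t0))).
{ revert t leT.
  apply (ode_nonneg t0 _ (fun t => dweight t - weight t0 * (- K * exp (- K * (t - t0))))
           (fun _ => - K)).
  - apply (ode_minus _ weight); [exact ode_weight | apply ode_scal, ode_exp].
  - rewrite Rminus_diag, Rmult_0_r, exp_0; lra.
  - intros t ltt; generalize (HK t (Rlt_le _ _ ltt)); intros H.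
    apply Rabs_le_between in H; lra.
  - intros t1; exists 0; intros; lra. }
assert (pE := exp_pos (- K * (t - t0))); nra.
Qed.

(** The weight w obeys w' >= (lam / 2) w - K w^2 eventually, and the logistic inequality
    becomes the linear relaxation inequality for - 1 / w. *)
Lemma weight_persists : 0 < lam -> 0 < weight t0 -> eventually_pos weight.
Proof.
intros plam W0.
pose (K := L / w2).
assert (K0 : 0 <= K) by (apply Rdiv_le_0_compat; lra).
pose (y := fun t => - / weight t); pose (dy := fun t => / weight t ^ 2 * dweight t).
assert (oy : ode t0 y dy).
{ apply (ode_comp t0 (fun z => - / z) (fun z => / z ^ 2)); [|exact ode_weight].
  intros t leT; assert (pW := weight_stays_pos t W0 leT).
  auto_derive; [lra | field; lra]. }
assert (plam2 : 0 < lam / 2) by lra.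
assert (low : eventually_R (fun t => - K / (lam / 2) - 1 <= y t)).
{ apply (relaxation_eventually_ge t0 (lam / 2) y dy); auto; [lra|].
  pose (M := (w1 * l2 + w2 * L) / w2).
  assert (M0 : 0 <= M) by (apply Rdiv_le_0_compat; nra).
  assert (small : 0 < lam / 2 / (M + 1)) by (apply Rdiv_lt_0_compat; lra).
  generalize (filter_and _ _ (eventually_ge t0) (decay_eventually _ small)).
  apply filter_imp; intros t [leT lee].
  destruct (drv_bounds _ _ _ _ _ _ _ sol t leT) as (bC & bR & _).
  destruct (drv_decay _ _ _ _ _ _ _ sol t leT) as (du & dv & _ & _).
  assert (pW := weight_stays_pos t W0 leT).
  destruct (weight_nonneg t leT) as [_ RW].
  set (E := B * exp (- nu * (t - t0))) in *.
  apply Rabs_le_between in du; apply Rabs_le_between in dv.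
  assert (growth : lam / 2 * weight t - K * weight t ^ 2 <= dweight t).
  { assert (w1l2 : 0 <= w1 * l2) by nra.
    assert (w2L : 0 <= w2 * L) by nra.
    assert (w1 * l2 * (u t - q - c t) >= - (w1 * l2 * E) - w1 * l2 * c t) by nra.
    assert (w2 * L * (v t - p - r t) >= - (w2 * L * E) - w2 * L * r t) by nra.
    assert (w1 * l2 * c t <= w1 * L * c t).
    { apply Rmult_le_compat_r; [lra | apply Rmult_le_compat_l; lra]. }
    assert (coef : (- (M * w2 * E) - L * weight t) * r t
       <= (w1 * l2 * (u t - q - c t) + w2 * L * (v t - p - r t)) * r t).
    { apply Rmult_le_compat_r; [lra|].
      replace (M * w2) with (w1 * l2 + w2 * L) by (unfold M; field; lra).
      unfold weight; lra. }
    assert (lin : M * E * (w2 * r t) <= lam / 2 * weight t).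
    { assert (E0 : 0 <= E) by (unfold E; apply Rmult_le_pos;
        [exact bound_nonneg | left; apply exp_pos]).
      apply Rle_trans with (M * E * weight t); [apply Rmult_le_compat_l; [nra | easy]|].
      apply Rmult_le_compat_r; [lra|].
      assert (lam / 2 / (M + 1) * (M + 1) = lam / 2) by (field; lra); nra. }
    assert (quad : K * weight t * (w2 * r t) <= K * weight t * weight t).
    { apply Rmult_le_compat_l; [apply Rmult_le_pos; lra | easy]. }
    replace (K * weight t * (w2 * r t)) with (L * weight t * r t) in quad
      by (unfold K; field; lra).
    unfold dweight; nra. }
  unfold y, dy.
  replace (- K - lam / 2 * - / weight t)
    with (/ weight t ^ 2 * (lam / 2 * weight t - K * weight t ^ 2))
    by (field; lra).
  apply Rmult_le_compat_l; [|easy].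
  left; apply Rinv_0_lt_compat, pow_lt; easy. }
assert (M0 : 0 < K / (lam / 2) + 1).
{ assert (0 <= K / (lam / 2)) by (apply Rdiv_le_0_compat; lra); lra. }
exists (/ (K / (lam / 2) + 1)); split; [now apply Rinv_0_lt_compat|].
generalize (filter_and _ _ (eventually_ge t0) low); apply filter_imp; intros t [leT Ht].
unfold y in Ht; assert (pW := weight_stays_pos t W0 leT).
rewrite <- (Rinv_inv (weight t)).
apply Rinv_le_contravar; [now apply Rinv_0_lt_compat|].
replace (- K / (lam / 2)) with (- (K / (lam / 2))) in Ht by (field; lra); lra.
Qed.

Lemma R_pos_of_pos_eigenvalue :
  0 < p -> 0 < lam -> 0 < weight t0 -> eventually_pos r.
Proof.
intros p0 plam W0.
destruct (weight_persists plam W0) as [d [pd Hd]].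
destruct (Req_dec w1 0) as [w10 | w1n].
{ exists (d / w2); split; [now apply Rdiv_lt_0_compat|].
  revert Hd; apply filter_imp; intros t Ht; unfold weight in Ht; rewrite w10 in Ht.
  apply (Rmult_le_reg_l w2); [easy|].
  replace (w2 * (d / w2)) with d by (field; lra); lra. }
assert (pl5 : 0 < l5) by nra.
destruct (drv_PR _ _ _ _ _ _ _ sol p0) as [m [pm Hm]].
pose (g := l5 / w1).
assert (pg : 0 < g) by (apply Rdiv_lt_0_compat; lra).
apply (relaxation_eventually_pos t0 (b + g * w2) (g * d) r _ (drv_R _ _ _ _ _ _ _ sol));
  [nra | nra |].
generalize (filter_and _ _ (eventually_ge t0) (filter_and _ _ Hd Hm)).
apply filter_imp; intros t [leT [hW hv]].
destruct (drv_bounds _ _ _ _ _ _ _ sol t leT) as (bC & bR & _).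
unfold rate_R; rewrite hk3_0.
replace (l5 * c t) with (g * weight t - g * w2 * r t) by (unfold g, weight; field; lra).
assert (0 <= L * r t * (v t - r t)) by (apply Rmult_le_pos; nra).
nra.
Qed.

End LeftEigenvector.
End OneSolution.

(** ** Comparison of two solutions *)

Lemma R_vanishes_of_p_zero (t0 nu B : R) (c r u v : R -> R) :
  driven_solution t0 nu B c r u v -> p = 0 -> is_lim r p_infty 0.
Proof.
intros sol p0.
apply is_lim_dominated with (K := 2 * B) (g := fun t => exp (- nu * (t - t0)));
  [|exact (is_lim_exp_decay _ _ (drv_nu _ _ _ _ _ _ _ sol))].
generalize (eventually_ge t0); apply filter_imp; intros t leT.
destruct (drv_bounds _ _ _ _ _ _ _ sol t leT) as (_ & bR & _).
destruct (drv_decay _ _ _ _ _ _ _ sol t leT) as (_ & dv & _ & dr).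
apply Rabs_le_between in dv; rewrite Rabs_pos_eq; lra.
Qed.

(** For l5 > 0 the off-diagonal entries l5 and l7 + l2 q are positive, and lam is the
    larger root of the characteristic equation (lam + a) (lam - (L p - b)) =
    l5 (l7 + l2 q); for l5 = 0 the matrix is triangular and (0, 1) works. *)
Lemma left_eigenvector_exists :
  k1 = 0 \/ l5 = 0 ->
  exists w1 w2 lam, 0 <= w1 /\ 0 < w2 /\ w1 * k1 = 0 /\
    - a * w1 + l5 * w2 = lam * w1 /\
    (l7 + l2 * q) * w1 + (L * p - b) * w2 = lam * w2.
Proof.
intros deg.
destruct (Req_dec l5 0) as [l50 | l5n].
{ exists 0, 1, (L * p - b); rewrite l50; lra. }
destruct deg as [k10 | l50]; [|easy].
pose (d := L * p - b); pose (n := l7 + l2 * q).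
pose (disc := (d + a) ^ 2 + 4 * (l5 * n)).
assert (pos : 0 < l5 * n) by (apply Rmult_lt_0_compat; [lra | exact hinfl]).
assert (sq : sqrt disc * sqrt disc = disc).
{ apply sqrt_sqrt; unfold disc; generalize (pow2_ge_0 (d + a)); lra. }
assert (s0 := sqrt_pos disc).
exists l5, ((d + a + sqrt disc) / 2), ((d - a + sqrt disc) / 2).
assert (big : 0 < d + a + sqrt disc).
{ apply Rnot_le_lt; intros le.
  assert (sqrt disc * sqrt disc <= (d + a) ^ 2) by nra.
  unfold disc at 3 in sq; lra. }
repeat split; [easy | lra | rewrite k10; ring | field |].
fold n d.
replace (n * l5) with ((sqrt disc * sqrt disc - (d + a) ^ 2) / 4)
  by (rewrite sq; unfold disc; field).
field.
Qed.

(** The alternative is decided by the parameters and by the common initial values, so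
    it cannot differ between the two solutions. *)
Lemma R_vanishes_or_persists (t0 nu B : R) (c r u v ca ra ua va : R -> R) :
  0 < L -> driven_solution t0 nu B c r u v -> driven_solution t0 nu B ca ra ua va ->
  c t0 = ca t0 -> r t0 = ra t0 ->
  is_lim r p_infty 0 /\ is_lim ra p_infty 0 \/
  0 < q /\ eventually_pos r /\ eventually_pos ra.
Proof.
intros pL sol sola c0 r0.
destruct (Rle_lt_or_eq_dec 0 p hp) as [pp | <-];
  [|left; split; eapply R_vanishes_of_p_zero; eauto].
assert (pq := hpq pp).
destruct (Rle_lt_or_eq_dec 0 k3 hk3) as [pk3 | k30].
{ right; split; [easy|]; split; eapply R_pos_of_k3; eauto. }
destruct (Rlt_dec 0 (k1 * l5)) as [pkl | nkl].
{ assert (0 < k1) by nra; assert (0 < l5) by nra.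
  right; split; [easy|]; split; eapply R_pos_of_C_pos; eauto;
    eapply C_pos_of_k1; eauto. }
assert (deg : k1 = 0 \/ l5 = 0).
{ destruct (Req_dec k1 0); [auto|]; right.
  destruct (Req_dec l5 0); [auto|]; exfalso; apply nkl; nra. }
destruct (left_eigenvector_exists deg) as (w1 & w2 & lam & h1 & h2 & hk & e1 & e2).
assert (sameW : weight c r w1 w2 t0 = weight ca ra w1 w2 t0).
{ unfold weight; now rewrite c0, r0. }
assert (W0 : 0 <= weight c r w1 w2 t0).
{ refine (proj1 (weight_nonneg _ _ _ _ _ _ _ sol _ _ h1 h2 t0 (Rle_refl _))). }
symmetry in k30.
destruct (Rle_lt_or_eq_dec _ _ W0) as [pW | zW].
2:{ symmetry in zW; left.
    split; [apply (R_vanishes_of_weight_zero _ _ _ _ _ _ _ sol w1 w2 lam)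
           |apply (R_vanishes_of_weight_zero _ _ _ _ _ _ _ sola w1 w2 lam)]; auto;
      now rewrite <- sameW. }
destruct (Rle_lt_dec lam 0) as [lamn | lamp].
- left; split; [apply (R_vanishes_of_nonpos_eigenvalue _ _ _ _ _ _ _ sol w1 w2 lam)
                |apply (R_vanishes_of_nonpos_eigenvalue _ _ _ _ _ _ _ sola w1 w2 lam)];
    auto.
- right; split; [easy|].
  split; [apply (R_pos_of_pos_eigenvalue _ _ _ _ _ _ _ sol w1 w2 lam)
         |apply (R_pos_of_pos_eigenvalue _ _ _ _ _ _ _ sola w1 w2 lam)]; auto;
    now rewrite <- sameW.
Qed.

Lemma small_coefficient (X Y : R) : 0 < X -> 0 <= Y -> exists d, 0 < d /\ Y * d <= X.
Proof.
intros pX pY; exists (X / (Y + 1)).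
assert (pd : 0 < X / (Y + 1)) by (apply Rdiv_lt_0_compat; lra).
split; [easy|].
assert (X / (Y + 1) * (Y + 1) = X) by (field; lra); lra.
Qed.

(** The functions f = (1 + (1 + tau) s) ca - c and g = (1 + s) ra - r satisfy a
    quasipositive system.  Its source in the g equation contains L s ra^2, the gain
    from sublinearity, which pays for the decay rate eta of s, for tau, and for the
    difference of the inputs (at most om s, and at most om where it is multiplied by
    s).  The C equation may have no such gain of its own (l2 and k1 can vanish);
    enlarging its ratio by the factor 1 + tau creates one, tau s ra (l7 + l2 ua), out
    of the influx from R. *)
Lemma ratio_comparison (t0 nu B T m n om tau eta S : R) (c r u v ca ra ua va : R -> R) :
  driven_solution t0 nu B c r u v -> driven_solution t0 nu B ca ra ua va ->
  t0 <= T -> 0 < m -> 0 < om -> 0 <= tau -> 0 <= eta -> 0 <= S -> 0 <= n ->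
  (forall t, T <= t -> m <= c t /\ m <= r t /\ m <= ca t /\ m <= ra t) ->
  (forall t, T <= t -> 0 <= u t - c t /\ n <= l7 + l2 * ua t) ->
  (forall t, T <= t ->
    let d := Rmin om (om * (S * exp (- eta * (t - T)))) in
    Rabs (u t - ua t) <= d /\ Rabs (v t - va t) <= d) ->
  B <= S * m ->
  (2 * l2 * B + k1) * om + (1 + tau) * B * eta <= tau * m * n ->
  (k3 + 2 * L * B) * om + l5 * B * tau + B * eta <= L * m ^ 2 ->
  forall t, T <= t ->
    let s := S * exp (- eta * (t - T)) in
    c t <= (1 + (1 + tau) * s) * ca t /\ r t <= (1 + s) * ra t.
Proof.
intros sol sola leT0 pm pom ptau peta pS pn low PC near SB small_c small_r t leT s.
pose (s1 := fun t => S * exp (- eta * (t - T))).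
pose (ds1 := fun t => S * (- eta * exp (- eta * (t - T)))).
pose (f := fun t => (1 + (1 + tau) * s1 t) * ca t - c t).
pose (g := fun t => (1 + s1 t) * ra t - r t).
assert (s1pos : forall t, 0 <= s1 t).
{ intros z; unfold s1; apply Rmult_le_pos; [easy | left; apply exp_pos]. }
assert (B0 := bound_nonneg _ _ _ _ _ _ _ sol).
assert (os : ode T s1 ds1) by (apply ode_scal, ode_exp).
assert (key : 0 <= f t /\ 0 <= g t); [|unfold f, g, s1 in key; unfold s; lra].
apply (quasipositive_nonneg T f g
  (fun t => (0 + (1 + tau) * ds1 t) * ca t
     + (1 + (1 + tau) * s1 t) * rate_C ca ra ua t - rate_C c r u t)
  (fun t => (0 + ds1 t) * ra t + (1 + s1 t) * rate_R ca ra va t - rate_R c r v t)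
  (fun t => - (a + k1 + l2 * (1 + s1 t) * ra t)) (fun t => l7 + l2 * (u t - c t))
  (fun t => - (b + k3) + L * (v t - r t - (1 + s1 t) * ra t)) (fun _ => l5)); auto.
- apply (ode_minus T (fun t => (1 + (1 + tau) * s1 t) * ca t)).
  + apply (ode_mult T (fun t => 1 + (1 + tau) * s1 t)).
    * apply (ode_plus T (fun _ => 1)); [apply ode_const | now apply ode_scal].
    * exact (ode_from _ _ _ _ leT0 (drv_C _ _ _ _ _ _ _ sola)).
  + exact (ode_from _ _ _ _ leT0 (drv_C _ _ _ _ _ _ _ sol)).
- apply (ode_minus T (fun t => (1 + s1 t) * ra t)).
  + apply (ode_mult T (fun t => 1 + s1 t)).
    * apply (ode_plus T (fun _ => 1)); [apply ode_const | easy].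
    * exact (ode_from _ _ _ _ leT0 (drv_R _ _ _ _ _ _ _ sola)).
  + exact (ode_from _ _ _ _ leT0 (drv_R _ _ _ _ _ _ _ sol)).
- destruct (drv_bounds _ _ _ _ _ _ _ sol T leT0) as (bC & _).
  destruct (low T (Rle_refl _)) as (_ & _ & lca & _).
  unfold f, s1; rewrite Rminus_diag, Rmult_0_r, exp_0, Rmult_1_r.
  assert (S * m <= S * ca T) by (apply Rmult_le_compat_l; easy).
  assert (0 <= tau * S * ca T) by (repeat apply Rmult_le_pos; lra); nra.
- destruct (drv_bounds _ _ _ _ _ _ _ sol T leT0) as (_ & bR & _).
  destruct (low T (Rle_refl _)) as (_ & _ & _ & lra').
  unfold g, s1; rewrite Rminus_diag, Rmult_0_r, exp_0, Rmult_1_r.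
  assert (S * m <= S * ra T) by (apply Rmult_le_compat_l; easy); nra.
- clear t leT s; intros t ltt.
  assert (leT : T <= t) by lra; assert (le0 : t0 <= t) by lra.
  destruct (drv_bounds _ _ _ _ _ _ _ sola t le0) as (bca & bra & bua & bva).
  destruct (low t leT) as (_ & _ & lca & lra').
  destruct (PC t leT) as [_ hn].
  destruct (near t leT) as [du _].
  fold (s1 t) in du; assert (s0 := s1pos t).
  assert (d1 := Rle_trans _ _ _ du (Rmin_l _ _)).
  assert (d2 := Rle_trans _ _ _ du (Rmin_r _ _)).
  unfold f, g, rate_C.
  replace (ds1 t) with (- eta * s1 t) by (unfold ds1, s1; ring).
  set (s := s1 t) in *; clearbody s.
  apply Rminus_le_0.
  (* What remains after the linear part is the gain from tau, the cost of s decaying,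
     two nonnegative terms, and two errors from the inputs. *)
  replace (_ - _) with
    (tau * s * ra t * (l7 + l2 * ua t) - (1 + tau) * eta * s * ca t
     + l2 * ra t * (1 + (1 + tau) * s) * s * ca t + k1 * (1 + tau) * s * ua t
     - (l2 * ra t + k1) * (u t - ua t) - l2 * ra t * s * (u t - ua t)) by ring.
  apply Rabs_le_between in d1; apply Rabs_le_between in d2.
  assert (g1 : tau * s * m * n <= tau * s * ra t * (l7 + l2 * ua t)).
  { apply Rmult_le_compat; [repeat apply Rmult_le_pos; lra | easy | | easy].
    apply Rmult_le_compat_l; [apply Rmult_le_pos; easy | easy]. }
  assert (g2 : eta * s * ca t * (1 + tau) <= eta * s * B * (1 + tau)).
  { apply Rmult_le_compat_r; [lra|].
    apply Rmult_le_compat_l; [apply Rmult_le_pos; easy | lra]. }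
  assert (g3 : 0 <= l2 * ra t * (1 + (1 + tau) * s) * s * ca t).
  { repeat apply Rmult_le_pos; try lra; nra. }
  assert (g4 : 0 <= k1 * (1 + tau) * s * ua t).
  { repeat apply Rmult_le_pos; lra. }
  assert (l2ra : 0 <= l2 * ra t <= l2 * B) by (split; nra).
  assert (oms : 0 <= om * s) by (apply Rmult_le_pos; lra).
  assert (g5 : (l2 * ra t + k1) * (u t - ua t) <= (l2 * B + k1) * (om * s)).
  { apply Rle_trans with ((l2 * ra t + k1) * (om * s));
      [apply Rmult_le_compat_l | apply Rmult_le_compat_r]; lra. }
  assert (g6 : l2 * ra t * s * (u t - ua t) <= l2 * B * s * om).
  { apply Rle_trans with (l2 * ra t * s * om);
      [apply Rmult_le_compat_l; [apply Rmult_le_pos; lra | lra]|].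
    apply Rmult_le_compat_r; [lra|]; apply Rmult_le_compat_r; lra. }
  generalize (Rmult_le_compat_r s _ _ s0 small_c); lra.
- clear t leT s; intros t ltt.
  assert (leT : T <= t) by lra; assert (le0 : t0 <= t) by lra.
  destruct (drv_bounds _ _ _ _ _ _ _ sola t le0) as (bca & bra & bua & bva).
  destruct (low t leT) as (_ & _ & lca & lra').
  destruct (near t leT) as [_ dv].
  fold (s1 t) in dv; assert (s0 := s1pos t).
  assert (d1 := Rle_trans _ _ _ dv (Rmin_l _ _)).
  assert (d2 := Rle_trans _ _ _ dv (Rmin_r _ _)).
  unfold f, g, rate_R.
  replace (ds1 t) with (- eta * s1 t) by (unfold ds1, s1; ring).
  set (s := s1 t) in *; clearbody s.
  apply Rminus_le_0.
  replace (_ - _) with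
    (L * (1 + s) * s * ra t ^ 2 - l5 * tau * s * ca t - eta * s * ra t
     + k3 * s * va t - (k3 + L * ra t) * (v t - va t) - L * ra t * s * (v t - va t)) by ring.
  apply Rabs_le_between in d1; apply Rabs_le_between in d2.
  assert (hL : 0 <= L) by lra.
  assert (g1 : L * s * m ^ 2 <= L * (1 + s) * s * ra t ^ 2).
  { assert (sq : m ^ 2 <= ra t ^ 2) by (apply pow_incr; lra).
    apply Rmult_le_compat; [apply Rmult_le_pos; easy | apply pow2_ge_0 | | easy].
    apply Rmult_le_compat_r; nra. }
  assert (g2 : l5 * tau * s * ca t <= l5 * tau * s * B).
  { apply Rmult_le_compat_l; [repeat apply Rmult_le_pos; easy | lra]. }
  assert (g3 : eta * s * ra t <= eta * s * B).
  { apply Rmult_le_compat_l; [apply Rmult_le_pos; easy | lra]. }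
  assert (g4 : 0 <= k3 * s * va t) by (repeat apply Rmult_le_pos; lra).
  assert (Lra : 0 <= L * ra t <= L * B) by (split; nra).
  assert (oms : 0 <= om * s) by (apply Rmult_le_pos; lra).
  assert (g5 : (k3 + L * ra t) * (v t - va t) <= (k3 + L * B) * (om * s)).
  { apply Rle_trans with ((k3 + L * ra t) * (om * s));
      [apply Rmult_le_compat_l | apply Rmult_le_compat_r]; lra. }
  assert (g6 : L * ra t * s * (v t - va t) <= L * B * s * om).
  { apply Rle_trans with (L * ra t * s * om);
      [apply Rmult_le_compat_l; [apply Rmult_le_pos; lra | lra]|].
    apply Rmult_le_compat_r; [lra|]; apply Rmult_le_compat_r; lra. }
  generalize (Rmult_le_compat_r s _ _ s0 small_r); lra.
- clear t leT s; intros t1.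
  exists (l7 + l2 * B + L * B + l5); intros t [ltt _].
  assert (leT : T <= t) by lra; assert (le0 : t0 <= t) by lra.
  destruct (drv_bounds _ _ _ _ _ _ _ sol t le0) as (bc & br & bu & bv).
  destruct (drv_bounds _ _ _ _ _ _ _ sola t le0) as (_ & bra & _).
  destruct (PC t leT) as [pc _].
  assert (s0 := s1pos t); set (s := s1 t) in *.
  assert (0 <= l2 * B) by nra.
  assert (0 <= L * B) by nra.
  assert (l2 * (u t - c t) <= l2 * B) by (apply Rmult_le_compat_l; lra).
  assert (0 <= l2 * (u t - c t)) by (apply Rmult_le_pos; lra).
  assert (0 <= (1 + s) * ra t) by (apply Rmult_le_pos; lra).
  assert (0 <= l2 * (1 + s) * ra t) by (rewrite Rmult_assoc; apply Rmult_le_pos; lra).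
  assert (L * (v t - r t - (1 + s) * ra t) <= L * B) by (apply Rmult_le_compat_l; lra).
  lra.
Qed.

Lemma inputs_merge (t0 nu B e : R) (c r u v ca ra ua va : R -> R) :
  driven_solution t0 nu B c r u v -> driven_solution t0 nu B ca ra ua va -> 0 < e ->
  eventually_R (fun t => Rabs (u t - ua t) <= e /\ Rabs (v t - va t) <= e).
Proof.
intros sol sola pe; assert (pe2 : 0 < e / 2) by lra.
generalize (filter_and _ _ (eventually_ge t0) (decay_eventually _ _ _ _ _ _ _ sol _ pe2)).
apply filter_imp; intros t [leT lee].
destruct (drv_decay _ _ _ _ _ _ _ sol t leT) as (du & dv & _).
destruct (drv_decay _ _ _ _ _ _ _ sola t leT) as (dua & dva & _).
apply Rabs_le_between in du, dv, dua, dva.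
split; apply Rabs_le_between; lra.
Qed.

(** The constants are chosen in the order m (lower bound of all components), tau, eta,
    om, then T, and S last: S has to dominate both the initial ratios and the
    differences of the inputs measured against om. *)
Lemma persistent_upper (t0 nu B : R) (c r u v ca ra ua va : R -> R) :
  0 < L -> 0 < q ->
  driven_solution t0 nu B c r u v -> driven_solution t0 nu B ca ra ua va ->
  eventually_pos r -> eventually_pos ra ->
  forall e, 0 < e -> eventually_R (fun t => c t - ca t <= e /\ r t - ra t <= e).
Proof.
intros pL pq sol sola pr pra e pe.
assert (B0 := bound_nonneg _ _ _ _ _ _ _ sol).
assert (pnu := drv_nu _ _ _ _ _ _ _ sol).
destruct (C_pos_of_R_pos _ _ _ _ _ _ _ sol pq pr) as [m1 [pm1 H1]].
destruct (C_pos_of_R_pos _ _ _ _ _ _ _ sola pq pra) as [m2 [pm2 H2]].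
destruct pr as [m3 [pm3 H3]]; destruct pra as [m4 [pm4 H4]].
destruct (drv_PC _ _ _ _ _ _ _ sol pq) as [m5 [pm5 H5]].
pose (m := Rmin (Rmin m1 m2) (Rmin m3 m4)).
assert (pm : 0 < m) by (repeat apply Rmin_glb_lt; easy).
assert (mle : m <= m1 /\ m <= m2 /\ m <= m3 /\ m <= m4).
{ unfold m; generalize (Rmin_l (Rmin m1 m2) (Rmin m3 m4)) (Rmin_r (Rmin m1 m2) (Rmin m3 m4))
    (Rmin_l m1 m2) (Rmin_r m1 m2) (Rmin_l m3 m4) (Rmin_r m3 m4); lra. }
clearbody m.
pose (n := (l7 + l2 * q) / 2); assert (pn : 0 < n) by (unfold n; lra).
assert (n2 : 2 * n = l7 + l2 * q) by (unfold n; field).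
clearbody n.
assert (pLm : 0 < L * m ^ 2 / 3).
{ assert (0 < m ^ 2) by (apply pow_lt; easy); nra. }
destruct (small_coefficient (L * m ^ 2 / 3) (l5 * B)) as [tau [ptau htau]]; [easy | nra |].
assert (ptn : 0 < tau * m * n / 2).
{ assert (0 < tau * m * n) by (repeat apply Rmult_lt_0_compat; easy); lra. }
destruct (small_coefficient (tau * m * n / 2) ((1 + tau) * B)) as [eta1 [peta1 heta1]];
  [easy | nra |].
destruct (small_coefficient (L * m ^ 2 / 3) B pLm B0) as [eta2 [peta2 heta2]].
destruct (small_coefficient (tau * m * n / 2) (2 * l2 * B + k1)) as [om1 [pom1 hom1]];
  [easy | nra |].
destruct (small_coefficient (L * m ^ 2 / 3) (k3 + 2 * L * B)) as [om2 [pom2 hom2]];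
  [easy | nra |].
pose (eta := Rmin nu (Rmin eta1 eta2)).
assert (peta : 0 < eta) by (repeat apply Rmin_glb_lt; easy).
assert (etale : eta <= nu /\ eta <= eta1 /\ eta <= eta2).
{ unfold eta; generalize (Rmin_l nu (Rmin eta1 eta2)) (Rmin_r nu (Rmin eta1 eta2))
    (Rmin_l eta1 eta2) (Rmin_r eta1 eta2); lra. }
clearbody eta.
pose (om := Rmin om1 om2).
assert (pom : 0 < om) by (apply Rmin_glb_lt; easy).
assert (omle : om <= om1 /\ om <= om2) by (split; [apply Rmin_l | apply Rmin_r]).
clearbody om.
destruct (small_coefficient n l2 pn (proj1 hl2)) as [d [pd hd]].
destruct (filter_and _ _
  (filter_and _ _ (filter_and _ _ H1 H2) (filter_and _ _ H3 H4))
  (filter_and _ _ H5 (filter_and _ _ (inputs_merge _ _ _ _ _ _ _ _ _ _ _ _ sol sola pom)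
     (decay_eventually _ _ _ _ _ _ _ sola _ pd)))) as [M HM].
pose (T := Rmax t0 (M + 1)).
assert (T0 : t0 <= T) by apply Rmax_l.
assert (TM : M < T) by (unfold T; generalize (Rmax_r t0 (M + 1)); lra).
clearbody T.
pose (S := B / m + 2 * B / om).
assert (S1 : 0 <= B / m) by (apply Rdiv_le_0_compat; easy).
assert (S2 : 0 <= 2 * B / om) by (apply Rdiv_le_0_compat; lra).
assert (cmp : forall t, T <= t ->
  let s := S * exp (- eta * (t - T)) in
  c t <= (1 + (1 + tau) * s) * ca t /\ r t <= (1 + s) * ra t).
{ apply (ratio_comparison t0 nu B T m n om tau eta S c r u v ca ra ua va);
    auto; try (unfold S; lra).
  - intros t leT; destruct (HM t ltac:(lra)) as [[[h1 h2] [h3 h4]] _]; lra.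
  - intros t leT; destruct (HM t ltac:(lra)) as [_ [h5 [_ h7]]].
    destruct (drv_decay _ _ _ _ _ _ _ sola t ltac:(lra)) as (dua & _).
    apply Rabs_le_between in dua.
    split; [lra|]; nra.
  - intros t leT dd; destruct (HM t ltac:(lra)) as [_ [_ [[hu hv] _]]].
    assert (le0 : t0 <= t) by lra.
    destruct (drv_decay _ _ _ _ _ _ _ sol t le0) as (du & dv & _).
    destruct (drv_decay _ _ _ _ _ _ _ sola t le0) as (dua & dva & _).
    assert (slow : exp (- nu * (t - t0)) <= exp (- eta * (t - T))).
    { destruct (Req_dec (- nu * (t - t0)) (- eta * (t - T))) as [-> | ne]; [lra|].
      left; apply exp_increasing; nra. }
    assert (far : 2 * (B * exp (- nu * (t - t0))) <= om * (S * exp (- eta * (t - T)))).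
    { replace (om * (S * exp (- eta * (t - T))))
        with (om * (B / m) * exp (- eta * (t - T)) + 2 * (B * exp (- eta * (t - T))))
        by (unfold S; field; lra).
      assert (0 <= om * (B / m) * exp (- eta * (t - T))).
      { apply Rmult_le_pos; [nra | left; apply exp_pos]. }
      assert (B * exp (- nu * (t - t0)) <= B * exp (- eta * (t - T)))
        by (apply Rmult_le_compat_l; easy).
      lra. }
    apply Rabs_le_between in du, dv, dua, dva.
    unfold dd; split; (apply Rmin_glb; [easy|]); apply Rabs_le_between; lra.
  - unfold S.
    replace ((B / m + 2 * B / om) * m) with (B + 2 * B / om * m) by (field; lra).
    assert (0 <= 2 * B / om * m) by (apply Rmult_le_pos; lra); lra.
  - assert ((2 * l2 * B + k1) * om <= (2 * l2 * B + k1) * om1)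
      by (apply Rmult_le_compat_l; nra).
    assert ((1 + tau) * B * eta <= (1 + tau) * B * eta1)
      by (apply Rmult_le_compat_l; nra).
    lra.
  - assert ((k3 + 2 * L * B) * om <= (k3 + 2 * L * B) * om2)
      by (apply Rmult_le_compat_l; nra).
    assert (B * eta <= B * eta2) by (apply Rmult_le_compat_l; lra).
    lra. }
assert (S0 : 0 <= S) by (unfold S; lra).
clearbody S.
destruct (small_coefficient e ((1 + tau) * B * S)) as [d2 [pd2 hd2]];
  [easy | repeat apply Rmult_le_pos; lra |].
generalize (filter_and _ _ (eventually_ge T) (exp_decay_eventually eta T d2 peta pd2)).
apply filter_imp; intros t [leT lee].
destruct (cmp t leT) as [hc hr].
destruct (drv_bounds _ _ _ _ _ _ _ sola t ltac:(lra)) as (bc & br & _).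
assert (pE := exp_pos (- eta * (t - T))); set (E := exp (- eta * (t - T))) in *.
assert (small : (1 + tau) * B * S * E <= e).
{ apply Rle_trans with (2 := hd2); apply Rmult_le_compat_l; [|easy].
  repeat apply Rmult_le_pos; lra. }
assert (0 <= S * E) by (apply Rmult_le_pos; lra).
assert (S * E * ca t <= S * E * B) by (apply Rmult_le_compat_l; lra).
assert (S * E * ra t <= S * E * B) by (apply Rmult_le_compat_l; lra).
assert (0 <= S * E * B) by (apply Rmult_le_pos; lra).
assert (tau * (S * E * ca t) <= tau * (S * E * B)) by (apply Rmult_le_compat_l; lra).
assert (0 <= tau * (S * E * B)) by (apply Rmult_le_pos; lra).
split; lra.
Qed.

(** Without the quadratic terms the matrix of the differences has a negative definite
    symmetric part, because the off-diagonal entries of the latter are (l5 + l7) / 2. *)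
Lemma linear_upper (t0 nu B : R) (c r u v ca ra ua va : R -> R) :
  L = 0 -> l5 + l7 < 2 * (a + k1) -> l5 + l7 < 2 * (b + k3) ->
  driven_solution t0 nu B c r u v -> driven_solution t0 nu B ca ra ua va ->
  forall e, 0 < e -> eventually_R (fun t => c t - ca t <= e /\ r t - ra t <= e).
Proof.
intros L0 dom_c dom_r sol sola e pe.
assert (B0 := bound_nonneg _ _ _ _ _ _ _ sol).
assert (l20 : l2 = 0) by lra.
pose (x := fun t => c t - ca t); pose (dx := fun t => rate_C c r u t - rate_C ca ra ua t).
pose (y := fun t => r t - ra t); pose (dy := fun t => rate_R c r v t - rate_R ca ra va t).
assert (ox : ode t0 x dx).
{ exact (ode_minus _ _ _ _ _ (drv_C _ _ _ _ _ _ _ sol) (drv_C _ _ _ _ _ _ _ sola)). }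
assert (oy : ode t0 y dy).
{ exact (ode_minus _ _ _ _ _ (drv_R _ _ _ _ _ _ _ sol) (drv_R _ _ _ _ _ _ _ sola)). }
pose (k := Rmin (2 * (a + k1) - (l5 + l7)) (2 * (b + k3) - (l5 + l7))).
assert (pk : 0 < k) by (apply Rmin_glb_lt; lra).
assert (kle : k <= 2 * (a + k1) - (l5 + l7) /\ k <= 2 * (b + k3) - (l5 + l7))
  by (split; [apply Rmin_l | apply Rmin_r]).
clearbody k.
assert (pe2 : 0 < e ^ 2 / 2) by (assert (0 < e ^ 2) by (apply pow_lt; easy); lra).
destruct (small_coefficient (k * (e ^ 2 / 2)) (2 * (k1 + k3) * B)) as [d [pd hd]];
  [nra | nra |].
assert (low : eventually_R (fun t => - (k * (e ^ 2 / 2)) / k - e ^ 2 / 2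
                                     <= - (x t * x t + y t * y t))).
{ apply (relaxation_eventually_ge t0 k _ (fun t => - (dx t * x t + x t * dx t
                                             + (dy t * y t + y t * dy t)))); auto.
  { apply ode_opp, ode_plus; apply ode_mult; easy. }
  generalize (filter_and _ _ (eventually_ge t0)
    (inputs_merge _ _ _ _ _ _ _ _ _ _ _ _ sol sola pd)).
  apply filter_imp; intros t [leT [hu hv]].
  destruct (drv_bounds _ _ _ _ _ _ _ sol t leT) as (bc & br & _).
  destruct (drv_bounds _ _ _ _ _ _ _ sola t leT) as (bca & bra & _).
  assert (xB : Rabs (x t) <= B) by (unfold x; apply Rabs_le_between; lra).
  assert (yB : Rabs (y t) <= B) by (unfold y; apply Rabs_le_between; lra).
  assert (force : forall z w, Rabs z <= B -> Rabs w <= d -> z * w <= B * d).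
  { intros z w hz hw; apply Rle_trans with (1 := Rle_abs _); rewrite Rabs_mult.
    apply Rmult_le_compat; auto using Rabs_pos. }
  assert (fu := Rmult_le_compat_l _ _ _ hk1 (force _ _ xB hu)).
  assert (fv := Rmult_le_compat_l _ _ _ hk3 (force _ _ yB hv)).
  replace (dx t) with (l7 * y t - (a + k1) * x t + k1 * (u t - ua t))
    by (unfold dx, x, y, rate_C; rewrite l20; ring).
  replace (dy t) with (l5 * x t - (b + k3) * y t + k3 * (v t - va t))
    by (unfold dy, x, y, rate_R; rewrite L0; ring).
  assert (cross : 2 * (l5 + l7) * (x t * y t) <= (l5 + l7) * (x t * x t + y t * y t)).
  { assert (0 <= (l5 + l7) * ((x t - y t) * (x t - y t)));
      [apply Rmult_le_pos; [lra | apply Rle_0_sqr] | nra]. }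
  assert (sx := Rmult_le_compat_r _ _ _ (Rle_0_sqr (x t)) (proj1 kle)).
  assert (sy := Rmult_le_compat_r _ _ _ (Rle_0_sqr (y t)) (proj2 kle)).
  unfold Rsqr in *; lra. }
revert low; apply filter_imp; intros t.
replace (- (k * (e ^ 2 / 2)) / k - e ^ 2 / 2) with (- (e * e)) by (field; lra).
fold (x t) (y t); intros H.
assert (X0 := Rle_0_sqr (x t)); assert (Y0 := Rle_0_sqr (y t)); unfold Rsqr in *.
split; apply Rnot_lt_le; intros lt; nra.
Qed.

(** The upper estimates for c - ca and r - ra are also lower estimates once the two
    solutions exchange their roles. *)
Lemma driven_solutions_merge (t0 nu B : R) (c r u v ca ra ua va : R -> R) :
  (L = 0 -> l5 + l7 < 2 * (a + k1) /\ l5 + l7 < 2 * (b + k3)) ->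
  driven_solution t0 nu B c r u v -> driven_solution t0 nu B ca ra ua va ->
  c t0 = ca t0 -> r t0 = ra t0 ->
  is_lim (fun t => c t - ca t) p_infty 0 /\ is_lim (fun t => r t - ra t) p_infty 0.
Proof.
intros dom sol sola c0 r0.
assert (two_sided :
  (forall e, 0 < e -> eventually_R (fun t => c t - ca t <= e /\ r t - ra t <= e)) ->
  (forall e, 0 < e -> eventually_R (fun t => ca t - c t <= e /\ ra t - r t <= e)) ->
  is_lim (fun t => c t - ca t) p_infty 0 /\ is_lim (fun t => r t - ra t) p_infty 0).
{ intros up lo; split; apply is_lim_eventually; intros e pe;
    generalize (filter_and _ _ (up e pe) (lo e pe)); apply filter_imp; intros t;
    rewrite Rminus_0_r, Rabs_le_between; lra. }
destruct (Rle_lt_or_eq_dec 0 L) as [pL | L0]; [lra| |].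
2:{ symmetry in L0; destruct (dom L0).
    apply two_sided; eapply linear_upper; eauto. }
destruct (R_vanishes_or_persists _ _ _ _ _ _ _ _ _ _ _ pL sol sola c0 r0)
  as [[lr lra'] | (pq & pr & pra)].
- assert (lim_minus : forall x y : R -> R, is_lim x p_infty 0 -> is_lim y p_infty 0 ->
    is_lim (fun t => x t - y t) p_infty 0).
  { intros x y hx hy; replace (Finite 0) with (Finite (0 - 0)) by (f_equal; ring).
    now apply is_lim_minus'. }
  split; [|now apply lim_minus].
  generalize (lim_minus _ _ (C_limit _ _ _ _ _ _ _ sol lr) (C_limit _ _ _ _ _ _ _ sola lra')).
  apply is_lim_ext; intros t; ring.
- apply two_sided; eapply persistent_upper; eauto.
Qed.

End DrivenSystem.

(** * The full and the reduced system *)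

Lemma ivp_ode (t0 x0 : R) (x f : R -> R) :
  ivp t0 x0 x f <-> x t0 = x0 /\ ode t0 x f.
Proof. easy. Qed.

Section FullSystem.

Context (l1 l2 l3 l4 l5 l6 l7 b1 b2 eps gam m mR alpha : R).
Context (hl1 : 0 <= l1) (hl2 : 0 <= l2) (hl3 : 0 <= l3) (hl4 : 0 <= l4).
Context (hl5 : 0 <= l5) (hl6 : 0 <= l6) (hl7 : 0 <= l7).
Context (hb1 : 0 <= b1) (hb2 : 0 <= b2) (heps : 0 < eps) (hgam : 0 <= gam).
Context (hm : 0 <= m) (hmR : 0 <= mR) (halpha : 0 <= alpha <= 1).

Let p : R := p_inf l5 l7 eps gam alpha.
Let q : R := q_inf l5 l7 eps gam alpha.
Let L : R := l2 + mR * l6.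
Let k1 : R := l1 + m * l4.
Let k3 : R := l3 + m * l4.
Let a : R := eps + b1 + l5.
Let b : R := eps + b2 + l7.

Lemma equilibrium_totals :
  (1 - alpha) * gam + l7 * p - (eps + l5) * q = 0 /\
  alpha * gam + l5 * q - (eps + l7) * p = 0.
Proof. unfold p, q, p_inf, q_inf; split; field; lra. Qed.

Lemma totals_nonneg : 0 <= p /\ 0 <= q.
Proof.
assert (0 < eps * (eps + l5 + l7)) by nra.
assert (0 <= alpha * eps) by nra; assert (0 <= (1 - alpha) * eps) by nra.
split; apply Rdiv_le_0_compat; auto; apply Rmult_le_pos; lra.
Qed.

Lemma rates_nonneg : 0 <= k1 /\ 0 <= k3 /\ 0 < a /\ 0 < b /\ 0 <= l2 <= L.
Proof.
assert (0 <= m * l4) by nra; assert (0 <= mR * l6) by nra.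
unfold k1, k3, a, b, L; lra.
Qed.

Lemma q_pos_gam : 0 < q -> 0 < gam /\ (0 < (1 - alpha) * gam \/ 0 < l7).
Proof.
intros pq; destruct (Req_dec gam 0) as [g0 | gn].
{ unfold q, q_inf in pq; rewrite g0 in pq; unfold Rdiv in pq; lra. }
split; [lra|].
destruct (Req_dec l7 0); [left | right; lra].
destruct (Req_dec alpha 1); [|nra].
unfold q, q_inf, Rdiv in pq; rewrite H, H0 in pq.
replace (gam * ((1 - 1) * eps + 0)) with 0 in pq by ring; lra.
Qed.

Lemma p_pos_gam : 0 < p -> 0 < gam /\ (0 < alpha * gam \/ 0 < l5).
Proof.
intros pp; destruct (Req_dec gam 0) as [g0 | gn].
{ unfold p, p_inf in pp; rewrite g0 in pp; unfold Rdiv in pp; lra. }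
split; [lra|].
destruct (Req_dec l5 0); [left | right; lra].
destruct (Req_dec alpha 0); [|nra].
unfold p, p_inf, Rdiv in pp; rewrite H, H0 in pp.
replace (gam * (0 * eps + 0)) with 0 in pp by ring; lra.
Qed.

(** Both totals vanish when gam = 0; for gam > 0 only l7 = 0 and alpha = 1 could give
    q = 0, and then l7 + l2 q = 0. *)
Lemma q_pos_of_p_pos : 0 < l7 + l2 * q -> 0 < p -> 0 < q.
Proof.
intros infl pp; destruct (p_pos_gam pp) as [pg _].
destruct (Req_dec l7 0) as [l70 | l7n].
{ destruct totals_nonneg as [_ q0]; rewrite l70 in infl; nra. }
assert (0 <= (1 - alpha) * eps) by nra.
apply Rdiv_lt_0_compat; apply Rmult_lt_0_compat; lra.
Qed.

Let E (t0 t : R) : R := exp (- (eps / 2) * (t - t0)).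

(** The vector (l7 + eps / 2, l5 + eps / 2) exp (- (eps / 2) t) is a supersolution of the
    exchange system with loss rates eps + l5 and eps + l7.  The exact decay rate eps
    belongs to (l7, l5), which has a zero entry when l5 or l7 vanishes; giving up half
    of the rate makes both entries positive. *)
Lemma exchange_exp_lower (t0 M : R) (x y dx dy kx ky : R -> R) :
  ode t0 x dx -> ode t0 y dy -> 0 <= M ->
  - (M * (l7 + eps / 2)) <= x t0 -> - (M * (l5 + eps / 2)) <= y t0 ->
  (forall t, t0 < t -> eps + l5 <= kx t /\ l7 * y t - kx t * x t <= dx t) ->
  (forall t, t0 < t -> eps + l7 <= ky t /\ l5 * x t - ky t * y t <= dy t) ->
  forall t, t0 <= t ->
    - (M * (l7 + l5 + eps / 2)) * E t0 t <= x t /\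
    - (M * (l7 + l5 + eps / 2)) * E t0 t <= y t.
Proof.
intros ox oy M0 x0 y0 Hx Hy t leT.
pose (A := M * (l7 + eps / 2)); pose (B := M * (l5 + eps / 2)).
assert (low : 0 <= x t + A * E t0 t /\ 0 <= y t + B * E t0 t).
{ revert t leT; unfold E.
  apply (quasipositive_nonneg t0 _ _
    (fun t => dx t + A * (- (eps / 2) * exp (- (eps / 2) * (t - t0))))
    (fun t => dy t + B * (- (eps / 2) * exp (- (eps / 2) * (t - t0))))
    (fun t => - kx t) (fun _ => l7) (fun t => - ky t) (fun _ => l5)).
  - apply (ode_plus t0 x); [easy | apply ode_scal, ode_exp].
  - apply (ode_plus t0 y); [easy | apply ode_scal, ode_exp].
  - rewrite Rminus_diag, Rmult_0_r, exp_0; unfold A; lra.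
  - rewrite Rminus_diag, Rmult_0_r, exp_0; unfold B; lra.
  - intros t ltt; destruct (Hx t ltt) as [hk hx].
    assert (pE := exp_pos (- (eps / 2) * (t - t0))).
    set (e := exp (- (eps / 2) * (t - t0))) in *.
    assert (0 <= (kx t - eps / 2) * A - l7 * B).
    { apply Rle_trans with ((eps + l5 - eps / 2) * A - l7 * B).
      - unfold A, B.
        replace (_ - _) with (M * ((eps / 2) * (eps / 2 + l5))) by field.
        apply Rmult_le_pos; [easy | nra].
      - apply Rplus_le_compat_r, Rmult_le_compat_r; [unfold A; nra | lra]. }
    assert (0 <= ((kx t - eps / 2) * A - l7 * B) * e) by (apply Rmult_le_pos; lra).
    lra.
  - intros t ltt; destruct (Hy t ltt) as [hk hy].
    assert (pE := exp_pos (- (eps / 2) * (t - t0))).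
    set (e := exp (- (eps / 2) * (t - t0))) in *.
    assert (0 <= (ky t - eps / 2) * B - l5 * A).
    { apply Rle_trans with ((eps + l7 - eps / 2) * B - l5 * A).
      - unfold A, B.
        replace (_ - _) with (M * ((eps / 2) * (eps / 2 + l7))) by field.
        apply Rmult_le_pos; [easy | nra].
      - apply Rplus_le_compat_r, Rmult_le_compat_r; [unfold B; nra | lra]. }
    assert (0 <= ((ky t - eps / 2) * B - l5 * A) * e) by (apply Rmult_le_pos; lra).
    lra.
  - intros t1; exists (l5 + l7); intros t [ltt _].
    destruct (Hx t ltt); destruct (Hy t ltt); lra. }
assert (pE := exp_pos (- (eps / 2) * (t - t0))); fold (E t0 t) in pE.
unfold A, B in low.
assert (0 <= M * l5 * E t0 t) by (repeat apply Rmult_le_pos; lra).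
assert (0 <= M * l7 * E t0 t) by (repeat apply Rmult_le_pos; lra).
split; lra.
Qed.

(** All errors d are eventually small against the source, which is g or j inf y. *)
Lemma eventually_pos_of_feed (t0 g j k : R) (x y dx : R -> R) :
  ode t0 x dx -> 0 <= g -> 0 <= j -> 0 < k ->
  (forall d, 0 < d -> eventually_R (fun t => - d <= y t)) ->
  (forall d, 0 < d -> eventually_R (fun t => g + j * y t - k * x t - d <= dx t)) ->
  0 < g \/ (0 < j /\ eventually_pos y) -> eventually_pos x.
Proof.
intros ox g0 j0 pk ylow Hx [pg | [pj [d [pd Hd]]]].
- apply (relaxation_eventually_pos t0 k (g / 2) x dx); auto; [lra|].
  destruct (small_coefficient (g / 4) j) as [d [pd hd]]; [lra | easy |].
  assert (pg4 : 0 < g / 4) by lra.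
  generalize (filter_and _ _ (ylow d pd) (Hx (g / 4) pg4)); apply filter_imp.
  intros t [hy hx]; nra.
- assert (pjd : 0 < j * d) by nra.
  apply (relaxation_eventually_pos t0 k (j * d / 2) x dx); auto; [lra|].
  assert (pjd2 : 0 < j * d / 2) by lra.
  generalize (filter_and _ _ Hd (Hx _ pjd2)); apply filter_imp.
  intros t [hy hx]; nra.
Qed.

(** The components P_C and P_R may start negative here, provided that the totals u and v
    do not; this is what lets the lemma apply to the reduced solution as well. *)
Lemma full_solution_driven (t0 c0 r0 pc0 pr0 : R) (c r pc pr : R -> R) :
  0 <= c0 -> 0 <= r0 -> 0 <= c0 + pc0 -> 0 <= r0 + pr0 ->
  full_solution l1 l2 l3 l4 l5 l6 l7 b1 b2 eps gam m mR alpha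
    t0 c0 r0 pc0 pr0 c r pc pr ->
  exists B0, forall B, B0 <= B ->
    driven_solution l2 L l5 l7 k1 k3 a b p q t0 (eps / 2) B
      c r (fun t => c t + pc t) (fun t => r t + pr t).
Proof.
intros hc0 hr0 hu0 hv0 sol; unfold full_solution in sol.
rewrite !ivp_ode in sol; destruct sol as [[ic oc] [[ir or] [[ipc opc] [ipr opr]]]].
destruct rates_nonneg as (hk1 & hk3 & pa & pb & hL).
destruct totals_nonneg as [p0 q0].
destruct equilibrium_totals as [eq_q eq_p].
pose (u := fun t => c t + pc t); pose (v := fun t => r t + pr t).
assert (ou : ode t0 u (fun t => (1 - alpha) * gam + l7 * v t - (eps + l5) * u t)).
{ generalize (ode_plus _ _ _ _ _ oc opc); apply ode_ext; [easy|].
  intros t _; unfold u, v; ring. }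
assert (ov : ode t0 v (fun t => alpha * gam + l5 * u t - (eps + l7) * v t)).
{ generalize (ode_plus _ _ _ _ _ or opr); apply ode_ext; [easy|].
  intros t _; unfold u, v; ring. }
assert (oc' : ode t0 c (rate_C l2 l7 k1 a c r u)).
{ revert oc; apply ode_ext; [easy|].
  intros t _; unfold rate_C, u, a, k1; ring. }
assert (or' : ode t0 r (rate_R L l5 k3 b c r v)).
{ revert or; apply ode_ext; [easy|].
  intros t _; unfold rate_R, v, b, k3, L; ring. }
assert (ag : 0 <= alpha * gam) by nra.
assert (ag' : 0 <= (1 - alpha) * gam) by nra.
assert (uv0 : forall t, t0 <= t -> 0 <= u t /\ 0 <= v t).
{ apply (quasipositive_nonneg t0 _ _ _ _ (fun _ => - (eps + l5)) (fun _ => l7)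
           (fun _ => - (eps + l7)) (fun _ => l5) ou ov).
  - unfold u; rewrite ic, ipc; lra.
  - unfold v; rewrite ir, ipr; lra.
  - intros t _; lra.
  - intros t _; lra.
  - intros t1; exists (l5 + l7); intros; lra. }
assert (cr0 : forall t, t0 <= t -> 0 <= c t /\ 0 <= r t).
{ apply (quasipositive_nonneg t0 _ _ _ _
    (fun t => - (a + k1 + l2 * r t)) (fun t => l7 + l2 * u t)
    (fun t => - (b + k3) + L * (v t - r t)) (fun _ => l5) oc' or'); [lra | lra | | |].
  - intros t ltt; destruct (uv0 t) as [u0 v0]; [lra|].
    unfold rate_C; assert (0 <= k1 * u t) by nra; lra.
  - intros t ltt; destruct (uv0 t) as [u0 v0]; [lra|].
    unfold rate_R; assert (0 <= k3 * v t) by nra; lra.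
  - intros t1.
    destruct (ode_locally_bounded _ _ _ or t1) as [Kr [Kr0 HKr]].
    destruct (ode_locally_bounded _ _ _ ou t1) as [Ku [Ku0 HKu]].
    destruct (ode_locally_bounded _ _ _ ov t1) as [Kv [Kv0 HKv]].
    exists (l5 + l7 + l2 * Kr + l2 * Ku + L * (Kv + Kr)); intros t [ltt lett].
    assert (tin : t0 <= t <= t1) by lra.
    generalize (HKr t tin) (HKu t tin) (HKv t tin); rewrite !Rabs_le_between; intros.
    destruct (uv0 t) as [u0 v0]; [lra|].
    assert (0 <= l2 * Kr) by nra; assert (0 <= l2 * Ku) by nra.
    assert (0 <= L * (Kv + Kr)) by nra.
    assert (- (l2 * Kr) <= l2 * r t) by nra.
    assert (0 <= l2 * u t <= l2 * Ku) by (split; nra).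
    assert (L * (v t - r t) <= L * (Kv + Kr)) by (apply Rmult_le_compat_l; lra).
    lra. }
pose (M := (Rabs (u t0 - q) + Rabs (v t0 - p) + Rabs pc0 + Rabs pr0) / (eps / 2)).
assert (M0 : 0 <= M).
{ apply Rdiv_le_0_compat; [|lra].
  generalize (Rabs_pos (u t0 - q)) (Rabs_pos (v t0 - p)) (Rabs_pos pc0) (Rabs_pos pr0); lra. }
assert (start : forall z l, 0 <= l -> Rabs z <= M * (eps / 2) ->
          - (M * (l + eps / 2)) <= z /\ - (M * (l + eps / 2)) <= - z).
{ intros z l hl hz; apply Rabs_le_between in hz; nra. }
assert (Meps : M * (eps / 2) = Rabs (u t0 - q) + Rabs (v t0 - p) + Rabs pc0 + Rabs pr0)
  by (unfold M; field; lra).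
clearbody M.
assert (abs_pos := conj (conj (Rabs_pos (u t0 - q)) (Rabs_pos (v t0 - p)))
                        (conj (Rabs_pos pc0) (Rabs_pos pr0))).
pose (D := M * (l7 + l5 + eps / 2)).
assert (D0 : 0 <= D) by (apply Rmult_le_pos; lra).
assert (oqu := ode_minus _ _ _ _ _ ou (ode_const t0 q)).
assert (opv := ode_minus _ _ _ _ _ ov (ode_const t0 p)).
(* The deviations of the totals satisfy the exchange system with equality, so both
   signs of them obey its lower bound; P_C and P_R satisfy it with larger loss rates
   and additional gains. *)
assert (lower_uv : forall t, t0 <= t -> - D * E t0 t <= u t - q /\ - D * E t0 t <= v t - p).
{ apply (exchange_exp_lower t0 M _ _ _ _ (fun _ => eps + l5) (fun _ => eps + l7) oqu opv M0);
    try (apply start; lra).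
  - intros t _; split; [lra|].
    replace 0 with ((1 - alpha) * gam + l7 * p - (eps + l5) * q); right; ring.
  - intros t _; split; [lra|].
    replace 0 with (alpha * gam + l5 * q - (eps + l7) * p); right; ring. }
assert (upper_uv : forall t, t0 <= t ->
          - D * E t0 t <= - (u t - q) /\ - D * E t0 t <= - (v t - p)).
{ apply (exchange_exp_lower t0 M _ _ _ _ (fun _ => eps + l5) (fun _ => eps + l7)
           (ode_opp _ _ _ oqu) (ode_opp _ _ _ opv) M0);
    try (apply start; lra).
  - intros t _; split; [lra|].
    replace 0 with ((1 - alpha) * gam + l7 * p - (eps + l5) * q); right; ring.
  - intros t _; split; [lra|].
    replace 0 with (alpha * gam + l5 * q - (eps + l7) * p); right; ring. }
assert (lower_P : forall t, t0 <= t -> - D * E t0 t <= pc t /\ - D * E t0 t <= pr t).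
{ apply (exchange_exp_lower t0 M _ _ _ _ (fun t => eps + l5 + k1 + l2 * r t)
           (fun t => eps + l7 + k3 + L * r t) opc opr M0);
    try (apply start; rewrite ?ipc, ?ipr; lra).
  - intros t ltt; destruct (cr0 t) as [ct rt]; [lra|].
    assert (0 <= l2 * r t) by nra; assert (0 <= b1 * c t) by nra.
    unfold k1 in *; split; lra.
  - intros t ltt; destruct (cr0 t) as [ct rt]; [lra|].
    assert (0 <= L * r t) by nra; assert (0 <= b2 * r t) by nra.
    unfold k3, L in *; split; lra. }
assert (E01 : forall t, t0 <= t -> 0 < E t0 t <= 1).
{ intros t leT; apply exp_decay_le1; lra. }
pose (B0 := p + q + 2 * D).
assert (bounds : forall t, t0 <= t ->
  (0 <= c t <= B0) /\ (0 <= r t <= B0) /\ (0 <= u t <= B0) /\ (0 <= v t <= B0)).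
{ intros t leT; generalize (E01 t leT) (uv0 t leT) (cr0 t leT) (upper_uv t leT)
    (lower_P t leT); intros.
  assert (D * E t0 t <= D) by nra.
  assert (u t = c t + pc t) by easy; assert (v t = r t + pr t) by easy.
  unfold B0; lra. }
assert (Esmall : forall N d, 0 <= N -> 0 < d -> eventually_R (fun t => N * E t0 t <= d)).
{ intros N d hN pd; destruct (small_coefficient d N pd hN) as [d' [pd' hd']].
  assert (peps2 : 0 < eps / 2) by lra.
  generalize (exp_decay_eventually _ t0 d' peps2 pd'); apply filter_imp; intros t hE.
  apply Rle_trans with (2 := hd'); now apply Rmult_le_compat_l. }
assert (low_pc : forall d, 0 < d -> eventually_R (fun t => - d <= pc t)).
{ intros d pd; generalize (filter_and _ _ (eventually_ge t0) (Esmall D d D0 pd)).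
  apply filter_imp; intros t [leT hE]; generalize (lower_P t leT); lra. }
assert (low_pr : forall d, 0 < d -> eventually_R (fun t => - d <= pr t)).
{ intros d pd; generalize (filter_and _ _ (eventually_ge t0) (Esmall D d D0 pd)).
  apply filter_imp; intros t [leT hE]; generalize (lower_P t leT); lra. }
assert (B00 : 0 <= B0) by (unfold B0; lra).
assert (feed_pc : 0 < (1 - alpha) * gam \/ 0 < l7 /\ eventually_pos pr -> eventually_pos pc).
{ apply (eventually_pos_of_feed t0 _ _ (eps + l5 + k1 + l2 * B0) pc pr _ opc); auto.
  - assert (0 <= l2 * B0) by nra; lra.
  - intros d pd.
    assert (hN : 0 <= l2 * B0 * D) by (apply Rmult_le_pos; [now apply Rmult_le_pos | easy]).
    generalize (filter_and _ _ (eventually_ge t0) (Esmall _ d hN pd)).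
    apply filter_imp; intros t [leT hE].
    destruct (bounds t leT) as ([ct _] & rt & _).
    destruct (lower_P t leT) as [hpc _].
    assert (0 <= b1 * c t) by nra.
    assert (slack : - (l2 * B0 * D * E t0 t) <= l2 * (B0 - r t) * pc t).
    { assert (s1 : 0 <= l2 * (B0 - r t)) by (apply Rmult_le_pos; lra).
      assert (s2 : l2 * (B0 - r t) <= l2 * B0) by (apply Rmult_le_compat_l; lra).
      assert (s3 : 0 <= D * E t0 t) by (apply Rmult_le_pos; [easy | apply Rlt_le, E01; easy]).
      assert (l2 * (B0 - r t) * (D * E t0 t) <= l2 * B0 * (D * E t0 t))
        by (apply Rmult_le_compat_r; easy).
      assert (l2 * (B0 - r t) * (- D * E t0 t) <= l2 * (B0 - r t) * pc t)
        by (apply Rmult_le_compat_l; easy).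
      lra. }
    unfold k1 in *; lra. }
assert (feed_pr : 0 < alpha * gam \/ 0 < l5 /\ eventually_pos pc -> eventually_pos pr).
{ apply (eventually_pos_of_feed t0 _ _ (eps + l7 + k3 + L * B0) pr pc _ opr); auto.
  - assert (0 <= L * B0) by nra; lra.
  - intros d pd.
    assert (hL0 : 0 <= L) by lra.
    assert (hN : 0 <= L * B0 * D) by (apply Rmult_le_pos; [now apply Rmult_le_pos | easy]).
    generalize (filter_and _ _ (eventually_ge t0) (Esmall _ d hN pd)).
    apply filter_imp; intros t [leT hE].
    destruct (bounds t leT) as ([ct _] & rt & _).
    destruct (lower_P t leT) as [_ hpr].
    assert (0 <= b2 * r t) by nra.
    assert (slack : - (L * B0 * D * E t0 t) <= L * (B0 - r t) * pr t).
    { assert (s1 : 0 <= L * (B0 - r t)) by (apply Rmult_le_pos; lra).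
      assert (s2 : L * (B0 - r t) <= L * B0) by (apply Rmult_le_compat_l; lra).
      assert (s3 : 0 <= D * E t0 t) by (apply Rmult_le_pos; [easy | apply Rlt_le, E01; easy]).
      assert (L * (B0 - r t) * (D * E t0 t) <= L * B0 * (D * E t0 t))
        by (apply Rmult_le_compat_r; easy).
      assert (L * (B0 - r t) * (- D * E t0 t) <= L * (B0 - r t) * pr t)
        by (apply Rmult_le_compat_l; easy).
      lra. }
    unfold k3, L in *; lra. }
exists B0; intros B leB; split; auto.
- lra.
- intros t leT; generalize (bounds t leT); fold (u t) (v t); lra.
- intros t leT E'; fold (u t) (v t).
  assert (small : D * E t0 t <= E').
  { unfold E'; fold (E t0 t); apply Rmult_le_compat_r; [apply Rlt_le, E01; easy|].
    unfold B0 in leB; lra. }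
  generalize (lower_uv t leT) (upper_uv t leT) (lower_P t leT); intros.
  assert (u t = c t + pc t) by easy; assert (v t = r t + pr t) by easy.
  rewrite !Rabs_le_between; lra.
- intros pq; destruct (q_pos_gam pq) as [pg src].
  assert (pos : eventually_pos pc).
  { (* If alpha = 1, only P_R has a source, which the exchange rate l7 passes on. *)
    apply feed_pc; destruct (Rlt_dec 0 ((1 - alpha) * gam)) as [src1 | nsrc]; [now left|].
    destruct src as [src1 | pl7]; [now left | right; split; [easy|]].
    apply feed_pr; left; nra. }
  destruct pos as [d [pd Hd]]; exists d; split; [easy|].
  revert Hd; apply filter_imp; intros t; lra.
- intros pp; destruct (p_pos_gam pp) as [pg src].
  assert (pos : eventually_pos pr).
  { apply feed_pr; destruct (Rlt_dec 0 (alpha * gam)) as [src1 | nsrc]; [now left|].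
    destruct src as [src1 | pl5]; [now left | right; split; [easy|]].
    apply feed_pc; left; nra. }
  destruct pos as [d [pd Hd]]; exists d; split; [easy|].
  revert Hd; apply filter_imp; intros t; lra.
Qed.

(** The equilibrium equations of (q, p) turn the derivative of q - ca into the right-hand
    side of the equation of P_C, and similarly for p - ra. *)
Lemma reduced_is_full (t0 c0 r0 : R) (ca ra : R -> R) :
  reduced_solution l1 l2 l3 l4 l5 l6 l7 b1 b2 eps m mR p q t0 c0 r0 ca ra ->
  full_solution l1 l2 l3 l4 l5 l6 l7 b1 b2 eps gam m mR alpha
    t0 c0 r0 (q - c0) (p - r0) ca ra (fun t => q - ca t) (fun t => p - ra t).
Proof.
intros sol; unfold reduced_solution in sol.
rewrite !ivp_ode in sol; destruct sol as [[ic oc] [ir or]].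
destruct equilibrium_totals as [eq_q eq_p].
split; [|split; [|split]]; apply ivp_ode; (split; [now rewrite ?ic, ?ir|]).
- generalize oc; apply ode_ext; [easy | intros t _; ring].
- generalize or; apply ode_ext; [easy | intros t _; ring].
- generalize (ode_minus _ _ _ _ _ (ode_const t0 q) oc); apply ode_ext; [easy|].
  intros t _; lra.
- generalize (ode_minus _ _ _ _ _ (ode_const t0 p) or); apply ode_ext; [easy|].
  intros t _; lra.
Qed.

End FullSystem.

(** Since x / 0 = 0, a quotient above 1 also certifies a nonzero denominator. *)
Lemma ratio_gt_1 (N d : R) : 0 <= d -> N / d > 1 -> 0 < d /\ d < N.
Proof.
intros d0 H; destruct (Req_dec d 0) as [-> | dn].
{ unfold Rdiv in H; rewrite Rinv_0 in H; lra. }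
split; [lra|].
replace N with (N / d * d) by (field; lra); nra.
Qed.

Theorem theorem2
  (l1 l2 l3 l4 l5 l6 l7 b1 b2 eps gam m mR alpha : R)
  (hl1 : 0 <= l1) (hl2 : 0 <= l2) (hl3 : 0 <= l3) (hl4 : 0 <= l4)
  (hl5 : 0 <= l5) (hl6 : 0 <= l6) (hl7 : 0 <= l7)
  (hb1 : 0 <= b1) (hb2 : 0 <= b2) (heps : 0 < eps) (hgam : 0 <= gam)
  (hm : 0 <= m) (hmR : 0 <= mR) (halpha : 0 <= alpha <= 1)
  (p q : R)
  (hp : p = p_inf l5 l7 eps gam alpha)
  (hq : q = q_inf l5 l7 eps gam alpha)
  (hmin :
    Rmin ((2 * eps + 2 * b1 + l5 + 2 * l1 + 2 * m * l4) / (l7 + q * l2))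
         ((2 * eps + 2 * b2 + l7 + 2 * l3 + 2 * m * l4
           + 2 * (l2 + mR * l6) * p) / (l5 + q * l2)) > 1)
  (t0 c0 r0 pc0 pr0 : R)
  (hc0 : 0 <= c0) (hr0 : 0 <= r0) (hpc0 : 0 <= pc0) (hpr0 : 0 <= pr0)
  (c r pc pr ca ra pca pra : R -> R)
  (hfull : full_solution l1 l2 l3 l4 l5 l6 l7 b1 b2 eps gam m mR alpha
             t0 c0 r0 pc0 pr0 c r pc pr)
  (hred : reduced_solution l1 l2 l3 l4 l5 l6 l7 b1 b2 eps m mR p q
            t0 c0 r0 ca ra)
  (hpra : forall t, pra t = p - ra t)
  (hpca : forall t, pca t = q - ca t) :
  is_lim (fun t => Rabs (c t - ca t) + Rabs (r t - ra t)
                   + Rabs (pc t - pca t) + Rabs (pr t - pra t))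
         p_infty 0.
Proof.
subst p q.
set (p := p_inf l5 l7 eps gam alpha) in *; set (q := q_inf l5 l7 eps gam alpha) in *.
assert (pq0 : 0 <= p /\ 0 <= q) by (apply totals_nonneg; easy).
destruct pq0 as [p0 q0].
assert (ql2 : 0 <= q * l2) by nra.
destruct (ratio_gt_1 (2 * eps + 2 * b1 + l5 + 2 * l1 + 2 * m * l4) (l7 + q * l2))
  as [infl dom_c]; [lra | eapply Rlt_le_trans; [exact hmin | apply Rmin_l] |].
destruct (ratio_gt_1 (2 * eps + 2 * b2 + l7 + 2 * l3 + 2 * m * l4
           + 2 * (l2 + mR * l6) * p) (l5 + q * l2))
  as [_ dom_r]; [lra | eapply Rlt_le_trans; [exact hmin | apply Rmin_r] |].
assert (infl' : 0 < l7 + l2 * q) by lra.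
assert (rates : 0 <= l1 + m * l4 /\ 0 <= l3 + m * l4 /\ 0 < eps + b1 + l5 /\
  0 < eps + b2 + l7 /\ 0 <= l2 <= l2 + mR * l6) by (apply rates_nonneg; easy).
destruct rates as (hk1 & hk3 & ha & hb & hL).
destruct (full_solution_driven l1 l2 l3 l4 l5 l6 l7 b1 b2 eps gam m mR alpha
  hl1 hl2 hl3 hl4 hl5 hl6 hl7 hb1 hb2 heps hgam hm hmR halpha
  t0 c0 r0 pc0 pr0 c r pc pr) as [B1 drv]; [lra | lra | lra | lra | easy |].
destruct (full_solution_driven l1 l2 l3 l4 l5 l6 l7 b1 b2 eps gam m mR alpha
  hl1 hl2 hl3 hl4 hl5 hl6 hl7 hb1 hb2 heps hgam hm hmR halpha
  t0 c0 r0 (q - c0) (p - r0) ca ra (fun t => q - ca t) (fun t => p - ra t))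
  as [B2 drva]; [lra | lra | lra | lra | now apply reduced_is_full |].
specialize (drv (Rmax B1 B2) (Rmax_l _ _)); specialize (drva (Rmax B1 B2) (Rmax_r _ _)).
set (B := Rmax B1 B2) in *.
assert (merge : is_lim (fun t => c t - ca t) p_infty 0 /\
                is_lim (fun t => r t - ra t) p_infty 0).
{ eapply (driven_solutions_merge l2 (l2 + mR * l6) l5 l7 (l1 + m * l4) (l3 + m * l4)
    (eps + b1 + l5) (eps + b2 + l7) p q); eauto.
  - now apply (q_pos_of_p_pos l2).
  - intros L0; assert (l20 : l2 = 0) by lra.
    rewrite L0 in dom_r; rewrite l20 in dom_c, dom_r; lra.
  - destruct hfull as [[-> _] _]; destruct hred as [[-> _] _]; easy.
  - destruct hfull as [_ [[-> _] _]]; destruct hred as [_ [-> _]]; easy. }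
destruct merge as [lc lr].
apply is_lim_eventually; intros e pe.
assert (pe6 : 0 < e / 6) by lra.
destruct hL as [hL1 hL2].
generalize (filter_and _ _ (eventually_ge t0) (filter_and _ _
  (decay_eventually _ _ _ _ _ _ _ _ _ _ _ _ _ _ _ _ _ drv _ pe6)
  (filter_and _ _ (eventually_is_lim _ _ _ lc pe6) (eventually_is_lim _ _ _ lr pe6)))).
apply filter_imp; intros t [leT [small [hc hr]]].
destruct (drv_decay _ _ _ _ _ _ _ _ _ _ _ _ _ _ _ _ _ drv t leT) as (du & dv & _).
cbv beta in du, dv; fold q in du; fold p in dv.
rewrite hpca, hpra, Rminus_0_r.
rewrite Rminus_0_r in hc, hr.
replace (pc t - (q - ca t)) with ((c t + pc t - q) - (c t - ca t)) by ring.
replace (pr t - (p - ra t)) with ((r t + pr t - p) - (r t - ra t)) by ring.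
assert (tri : forall x y, Rabs (x - y) <= Rabs x + Rabs y).
{ intros x y; generalize (Rabs_triang x (- y)); rewrite Rabs_Ropp; easy. }
assert (H1 := tri (c t + pc t - q) (c t - ca t)).
assert (H2 := tri (r t + pr t - p) (r t - ra t)).
rewrite Rabs_pos_eq; [lra|].
repeat apply Rplus_le_le_0_compat; apply Rabs_pos.
Qed.
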